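(* For every composition $\lambda\in\Gamma$ of $r$, the chain complex $\widetilde{C}^\lambda_*$ is exact in degree $-1$; that is, the map $d_0^\lambda\colon C_0^\lambda=\mathrm{Hom}_R(M^\lambda,R)\to C_{-1}^\lambda=\mathrm{Hom}_R(S^\lambda,R)$ is surjective.
   Context: Hecke algebra. $R$ is an integral domain, $q\in R$ a unit, $r$ a positive integer. $W$ is the symmetric group on $\{1,\ldots,r\}$, acting from the right (so $i(vw)=(iv)w$), $S=\{(i,i+1)\mid 1\le i\le r-1\}$, and $l$ is the length function with respect to $S$. $\mathcal{H}$ is the $R$-algebra with $R$-basis $T_w$ ($w\in W$), identity $T_1$, and multiplication determined, for $w\in W$, $s\in S$, by $T_wT_s=T_{ws}$ if $l(ws)=l(w)+1$ and $T_wT_s=qT_{ws}+(q-1)T_w$ if $l(ws)=l(w)-1$. Unadorned $\otimes$ is over $R$. Compositions. $\Gamma$ is the set of compositions $\lambda=(\lambda_1,\lambda_2,\ldots)$ of $r$ (sequences of non-negative integers with sum $r$), $\Lambda\subseteq\Gamma$ the set of partitions (weakly decreasing compositions). For $\lambda,\mu\in\Gamma$, $\lambda\trianglelefteq\mu$ means $\sum_{i=1}^e\lambda_i\le\sum_{i=1}^e\mu_i$ for all $e\ge1$; $\lambda\triangleleft\mu$ means $\lambda\trianglelefteq\mu$ and $\lambda\ne\mu$. For $\lambda\in\Lambda$, $\lambda'$ is the conjugate partition. Permutation modules. For $\lambda\in\Gamma$ let $P_i=P_i^\lambda=\{\lambda_1+\cdots+\lambda_{i-1}+1,\ldots,\lambda_1+\cdots+\lambda_i\}$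 and let $W_\lambda$ be the subgroup of all $w\in W$ with $P_iw=P_i$ for all $i$. Put $x_\lambda=\sum_{w\in W_\lambda}T_w$ and $M^\lambda=x_\lambda\mathcal{H}$ (a right $\mathcal{H}$-module). $\mathcal{D}_\lambda$ is the set of the unique shortest elements of the cosets $W_\lambda w$; the elements $x_\lambda T_d$ ($d\in\mathcal{D}_\lambda$) form an $R$-basis of $M^\lambda$. Specht modules. A $\lambda$-tableau is a bijective filling of the Young diagram of $\lambda$ ($\lambda_i$ boxes in row $i$) with $1,\ldots,r$; $W$ acts on tableaux from the right by acting on the entries. $t^\lambda$ is the $\lambda$-tableau with entries $1,\ldots,r$ in order along the rows, from the first row downwards. For $\lambda\in\Lambda$, $w_\lambda\in W$ is defined by the property that the transpose of $t^\lambda w_\lambda$ is $t^{\lambda'}$; $y_\lambda=\sum_{w\in W_\lambda}(-q)^{-l(w)}T_w$, $z_\lambda=x_\lambda T_{w_\lambda}y_{\lambda'}$, and $S^\lambda=z_\lambda\mathcal{H}\subseteq M^\lambda$. If $\lambda\in\Gamma$ is not a partition, $S^\lambda:=0$. Homomorphisms. For $\lambda,\mu\in\Gamma$ let $\mathcal{D}_{\lambda,\mu}=\mathcal{D}_\lambda\cap\mathcal{D}_\mu^{-1}$, a set of representatives of $W_\lambda\backslash W/W_\mu$. $\mathrm{Hom}_{\mathcal{H}}(M^\mu,M^\lambda)$ has $R$-basis $\varphi_d^{\lambda,\mu}$ ($d\in\mathcal{D}_{\lambda,\mu}$), where $\varphi_d^{\lambda,\mu}(x_\mu)=\sum_{w\in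 W_\lambda dW_\mu}T_w$. Let $\mathcal{D}^\wedge_{\lambda,\mu}$ be the set of $d\in\mathcal{D}_{\lambda,\mu}$ with $P^\lambda_i d\subseteq\bigcup_{j\ge i}P^\mu_j$ for all $i\ge1$ (equivalently, the corresponding row-semistandard generalized tableau of shape $\lambda$ and content $\mu$ has only entries $\ge i$ in its $i$-th row, for every $i$). Put $\mathrm{Hom}^\wedge_{\mathcal{H}}(M^\mu,M^\lambda)=\bigoplus_{d\in\mathcal{D}^\wedge_{\lambda,\mu}}R\varphi_d^{\lambda,\mu}$. Composites of such homomorphisms again lie in the corresponding module $\mathrm{Hom}^\wedge_{\mathcal{H}}$. Chain complex. For $n\ge0$ let $\Delta_n^\lambda$ be the set of chains $\gamma=(\lambda^{(0)}\triangleleft\cdots\triangleleft\lambda^{(n)})$ in $\Gamma$ with $\lambda^{(0)}=\lambda$, let $M_\gamma=\mathrm{Hom}^\wedge_{\mathcal{H}}(M^{\lambda^{(0)}},M^{\lambda^{(1)}})\otimes\cdots\otimes\mathrm{Hom}^\wedge_{\mathcal{H}}(M^{\lambda^{(n-1)}},M^{\lambda^{(n)}})\otimes\mathrm{Hom}_R(M^{\lambda^{(n)}},R)$, and $C_n^\lambda=\bigoplus_{\gamma\in\Delta_n^\lambda}M_\gamma$. $C_n^\lambda$ is a left $\mathcal{H}$-module via the action $(h\varepsilon)(m)=\varepsilon(mh)$ on the last tensor factor. For $n\ge1$, $d_n^\lambda=\sum_{i=1}^n(-1)^{i-1}d_{n,i}^\lambda\colon C_n^\lambda\to C_{n-1}^\lambda$,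 where $d_{n,i}^\lambda$ maps $M_\gamma$ to $M_{\gamma_i}$ ($\gamma_i$ is $\gamma$ with $\lambda^{(i)}$ omitted) by $\varphi_1\otimes\cdots\otimes\varphi_n\otimes\varepsilon\mapsto\varphi_1\otimes\cdots\otimes(\varphi_{i+1}\circ\varphi_i)\otimes\cdots\otimes\varphi_n\otimes\varepsilon$, with $\varphi_{n+1}$ read as $\varepsilon$ when $i=n$. Finally $C_{-1}^\lambda=\mathrm{Hom}_R(S^\lambda,R)$ and $d_0^\lambda\colon C_0^\lambda=\mathrm{Hom}_R(M^\lambda,R)\to C_{-1}^\lambda$ is restriction $\varepsilon\mapsto\varepsilon|_{S^\lambda}$. $\widetilde{C}_*^\lambda$ is the resulting chain complex $0\to C^\lambda_{a(\lambda)}\to\cdots\to C_1^\lambda\to C_0^\lambda\to C_{-1}^\lambda\to0$, where $a(\lambda)$ is the largest $n$ with $\Delta_n^\lambda\neq\emptyset$. *)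

(* Defs.v *)
From HB Require Import structures.
From mathcomp Require Import all_boot all_order all_fingroup all_algebra.
From mathcomp Require Import boolp.

Set Implicit Arguments.
Unset Strict Implicit.
Unset Printing Implicit Defensive.

Import GRing.Theory.
Local Open Scope ring_scope.

(* Indices are 0-based: k : 'I_r stands for the point k + 1 of {1, ..., r},
   and lam i for the part lambda_(i+1). MathComp permutations act from the
   right: (v * w) i = w (v i). *)

Section SymmetricGroup.

Context (r : nat).
Implicit Types (i j k : 'I_r) (w : 'S_r).

Definition simple_refl : {set 'S_r} :=
  [set tperm ij.1 ij.2 | ij : 'I_r * 'I_r & ij.2 == ij.1.+1 :> nat].

Lemma simple_refl_gen : <<simple_refl>>%g = [set: 'S_r].
Proof.
have step i j : j = i.+1 :> nat -> tperm i j \in <<simple_refl>>%g.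
  move=> ij; apply/mem_gen/imsetP; exists (i, j) => //.
  by rewrite inE /= ij.
have all_tp i n : forall j, j = (i + n)%N :> nat -> tperm i j \in <<simple_refl>>%g.
  elim: n => [|n IH] j ij.
    by rewrite (_ : j = i) ?tperm1 ?group1 //; apply: val_inj; rewrite /= ij addn0.
  have lt_k : (i + n < r)%N by rewrite -addnS -ij ltnW.
  pose k := Ordinal lt_k.
  have kj : j = k.+1 :> nat by rewrite ij addnS.
  have [eik|neik] := eqVneq i k; first by rewrite eik step.
  have nkj : k != j by rewrite -val_eqE /= kj neq_ltn ltnS leqnn.
  have nij : i != j by rewrite -val_eqE /= ij neq_ltn addnS ltnS leq_addr.
  rewrite -(_ : tperm i k ^ tperm k j = tperm i j)%g; last first.
    by rewrite tpermJ tpermL tpermD // eq_sym.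
  by rewrite groupJ ?IH ?step.
apply/eqP; rewrite eqEsubset subsetT /=; apply/subsetP => w _.
have [ts -> _] := prod_tpermP w; rewrite group_prod // => -[i j] _ /=.
by case: (leqP i j) => [|/ltnW] le; [|rewrite tpermC];
  apply: (all_tp _ _ _ (esym (subnKC le))).
Qed.

(* In group_scope S ^+ n is the set of products of n elements of S. *)
Lemma simple_word_ex w : exists n, w \in (simple_refl ^+ n)%g.
Proof.
have : w \in <<simple_refl>>%g by rewrite simple_refl_gen inE.
case/gen_prodgP=> n [c cS ->]; exists n.
elim: n c cS => [|n IH] c cS; first by rewrite big_ord0 expg0 inE.
by rewrite big_ord_recl expgS mem_mulg ?IH.
Qed.

Definition length w : nat := ex_minn (simple_word_ex w).

End SymmetricGroup.

Section Compositions.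

Implicit Types lam : nat -> nat.

(* The infinite sum of the parts is r: the partial sums are eventually r. *)
Definition is_composition (r : nat) lam : Prop :=
  exists n, forall m, (n <= m)%N -> (\sum_(i < m) lam i)%N = r.

Definition is_partition lam : Prop := forall i, (lam i.+1 <= lam i)%N.

(* The number of i with lam i > j; only i < r can contribute when lam is a
   partition of r. *)
Definition conj_part (r : nat) lam : nat -> nat :=
  fun j => (\sum_(i < r) (j < lam i))%N.

(* The entry of the row-reading tableau t^lam in box (i, j), j < lam i. *)
Definition row_entry lam (i j : nat) : nat := (\sum_(a < i) lam a + j)%N.

Definition block (r : nat) lam (i : nat) : {set 'I_r} :=
  [set k : 'I_r | (row_entry lam i 0 <= k < row_entry lam i.+1 0)%N].

Definition young_subgroup (r : nat) lam : {set 'S_r} :=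
  [set w : 'S_r | `[< forall i, w @: block r lam i = block r lam i >]].

Definition transposes (r : nat) lam (w : 'S_r) : Prop :=
  forall i j (k : 'I_r), (j < lam i)%N -> k = row_entry lam i j :> nat ->
    w k = row_entry (conj_part r lam) j i :> nat.

(* The default 1 is irrelevant when lam is a partition of r: see
   w_partP and transposes_inj. *)
Definition w_part (r : nat) lam : 'S_r :=
  odflt 1%g [pick w : 'S_r | `[< transposes lam w >]].

Lemma psum_homo lam m n : (m <= n)%N -> (\sum_(i < m) lam i <= \sum_(i < n) lam i)%N.
Proof.
move=> /subnKC <-; elim: (n - m)%N => [|d IH]; first by rewrite addn0.
by rewrite addnS big_ord_recr /= (leq_trans IH) ?leq_addr.
Qed.

Lemma composition_psum_le r lam m : is_composition r lam ->
  (\sum_(i < m) lam i <= r)%N.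
Proof.
by case=> n hn; rewrite -(hn _ (leq_maxl n m)) psum_homo ?leq_maxr.
Qed.

Lemma row_entry_ex r lam (k : 'I_r) : is_composition r lam ->
  exists ij : nat * nat, (ij.2 < lam ij.1)%N && (k == row_entry lam ij.1 ij.2 :> nat).
Proof.
case=> n hn.
have ex : exists m, (k < \sum_(a < m) lam a)%N by exists n; rewrite hn.
case: (ex_minnP ex) => -[|m]; first by rewrite big_ord0.
rewrite big_ord_recr /= => lt_k min_m.
have le_k : (\sum_(a < m) lam a <= k)%N.
  by rewrite leqNgt; apply/negP => /min_m; rewrite ltnn.
exists (m, k - \sum_(a < m) lam a)%N; rewrite /row_entry /= subnKC // eqxx andbT.
by rewrite ltn_subLR.
Qed.

Lemma row_entry_inj lam i j i' j' : (j < lam i)%N -> (j' < lam i')%N ->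
  row_entry lam i j = row_entry lam i' j' -> (i, j) = (i', j').
Proof.
have lt a b c d : (b < lam a)%N -> (a < c)%N ->
    (row_entry lam a b < row_entry lam c d)%N.
  move=> hb hac; rewrite /row_entry; apply: leq_trans (leq_addr _ _).
  by apply: leq_trans (psum_homo _ hac); rewrite big_ord_recr /= ltn_add2l.
move=> hj hj' e; have [h|h|ii] := ltngtP i i'.
- by have := lt _ _ _ j' hj h; rewrite e ltnn.
- by have := lt _ _ _ j hj' h; rewrite e ltnn.
by move: e; rewrite ii => /addnI ->.
Qed.

Section Partition.

Context (r : nat) (lam : nat -> nat).
Context (hc : is_composition r lam) (hp : is_partition lam).

Lemma part_homo i i' : (i <= i')%N -> (lam i' <= lam i)%N.
Proof.
move=> /subnKC <-; elim: (i' - i)%N => [|d IH]; first by rewrite addn0.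
by rewrite addnS (leq_trans (hp _)).
Qed.

Lemma part_row_bound i j : (j < lam i)%N -> (i < r)%N.
Proof.
move=> hj; apply: leq_trans (composition_psum_le i.+1 hc).
rewrite -[X in (X <= _)%N]card_ord -sum1_card; apply: leq_sum => a _ /=.
by apply: leq_trans (leq_ltn_trans (leq0n j) hj) (part_homo _); rewrite -ltnS.
Qed.

Lemma part_col_bound i j : (j < lam i)%N -> (j < r)%N.
Proof.
move=> hj; apply: leq_trans (composition_psum_le i.+1 hc).
by rewrite big_ord_recr /= (leq_trans hj) ?leq_addl.
Qed.

Lemma sum_part : (\sum_(i < r) lam i)%N = r.
Proof.
case: hc => n hn; rewrite -[RHS](hn _ (leq_maxl n r)).
rewrite -(subnKC (leq_maxr n r)) big_split_ord /= [X in (_ + X)%N]big1 ?addn0 //.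
move=> a _; apply/eqP; rewrite -leqn0 leqNgt; apply/negP => /part_row_bound.
by rewrite ltnNge leq_addr.
Qed.

Lemma conj_partP i j : (j < lam i)%N -> (i < conj_part r lam j)%N.
Proof.
move=> hj; have hi := part_row_bound hj.
rewrite /conj_part -(subnKC hi) big_split_ord /= ltn_addr //.
rewrite -[X in (X <= _)%N]card_ord -sum1_card; apply: leq_sum => a _ /=.
by rewrite lt0b (leq_trans hj) // part_homo -1?ltnS.
Qed.

Lemma sum_conj_part : (\sum_(j < r) conj_part r lam j)%N = r.
Proof.
rewrite exchange_big /= -[RHS]sum_part; apply: eq_bigr => i _.
have le : (lam i <= r)%N.
  case e : (lam i) => [//|m]; rewrite -e.
  by rewrite e; apply: (@part_col_bound i); rewrite e.
move: (lam i) le => m le.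
rewrite -(subnKC le) big_split_ord /= [X in (_ + X)%N]big1 ?addn0.
  by rewrite (eq_bigr (fun=> 1%N)) => [|a _]; rewrite ?sum1_card ?card_ord ?ltn_ord.
by move=> a _; rewrite ltnNge leq_addr.
Qed.

Lemma w_part_ex : exists w : 'S_r, transposes lam w.
Proof.
pose box k := xchoose (row_entry_ex k hc).
have boxP k : ((box k).2 < lam (box k).1)%N && (k == row_entry lam (box k).1 (box k).2 :> nat).
  exact: xchooseP (row_entry_ex k hc).
have lt k : (row_entry (conj_part r lam) (box k).2 (box k).1 < r)%N.
  have /andP[hk _] := boxP k.
  rewrite -[X in (_ < X)%N]sum_conj_part.
  apply: leq_trans (psum_homo _ (part_col_bound hk)).
  by rewrite big_ord_recr /= ltn_add2l conj_partP.
pose f k := Ordinal (lt k).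
have f_inj : injective f.
  move=> k k' /(congr1 val) /= e; apply: val_inj => /=.
  have /andP[hk /eqP ->] := boxP k; have /andP[hk' /eqP ->] := boxP k'.
  by case: (row_entry_inj (conj_partP hk) (conj_partP hk') e) => -> ->.
exists (perm f_inj) => i j k hj hk; rewrite permE /=.
have /andP[hb /eqP eb] := boxP k.
by case: (row_entry_inj hb hj (etrans (esym eb) hk)) => -> ->.
Qed.

Lemma w_partP : transposes lam (w_part r lam).
Proof.
rewrite /w_part; case: pickP => [w /asboolP //|h].
by have [w /asboolP] := w_part_ex; rewrite h.
Qed.

Lemma transposes_inj (v w : 'S_r) : transposes lam v -> transposes lam w -> v = w.
Proof.
move=> hv hw; apply/permP => k; have [[i j] /andP[hj /eqP hk]] := row_entry_ex k hc.
by apply: val_inj; rewrite /= (hv _ _ _ hj hk) (hw _ _ _ hj hk).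
Qed.

End Partition.

End Compositions.

Record is_hecke_algebra (R : idomainType) (q : R) (r : nat) (H : algType R)
    (T : 'S_r -> H) : Prop := IsHeckeAlgebra {
  hecke_basis : forall h : H,
    exists! c : {ffun 'S_r -> R}, h = \sum_w c w *: T w;
  hecke_one : T 1%g = 1;
  hecke_mul_up : forall w s : 'S_r, s \in simple_refl r ->
    length (w * s)%g = (length w + 1)%N -> T w * T s = T (w * s)%g;
  hecke_mul_down : forall w s : 'S_r, s \in simple_refl r ->
    length w = (length (w * s)%g + 1)%N ->
    T w * T s = q *: T (w * s)%g + (q - 1) *: T w }.

Section Modules.

Context (R : idomainType) (q : R) (r : nat) (H : algType R) (T : 'S_r -> H).
Context (lam : nat -> nat).

Definition x_elt : H := \sum_(w in young_subgroup r lam) T w.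

Definition y_elt (mu : nat -> nat) : H :=
  \sum_(w in young_subgroup r mu) (- q) ^- length w *: T w.

Definition z_elt : H :=
  x_elt * T (w_part r lam) * y_elt (conj_part r lam).

Definition right_ideal (a : H) : {pred H} := fun h => `[< exists b, h = a * b >].

Definition perm_pred : {pred H} := right_ideal x_elt.

Definition specht_pred : {pred H} :=
  fun h => if `[< is_partition lam >] then h \in right_ideal z_elt else h == 0.

Lemma right_ideal_submod_closed (a : H) : submod_closed (right_ideal a).
Proof.
split=> [|c u v /asboolP[b ->] /asboolP[b' ->]]; apply/asboolP.
  by exists 0; rewrite mulr0.
by exists (c *: b + b'); rewrite mulrDr scalerAr.
Qed.

Lemma perm_submod_closed : submod_closed perm_pred.
Proof. exact: right_ideal_submod_closed. Qed.

Lemma specht_submod_closed : submod_closed specht_pred.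
Proof.
have [h0 hD] := right_ideal_submod_closed z_elt.
rewrite /specht_pred; split=> [|c u v]; rewrite !unfold_in; case: ifP => // _.
  exact: hD.
by move=> /eqP-> /eqP->; rewrite scaler0 addr0.
Qed.

HB.instance Definition _ :=
  GRing.isSubmodClosed.Build R H perm_pred perm_submod_closed.
HB.instance Definition _ :=
  GRing.isSubmodClosed.Build R H specht_pred specht_submod_closed.

Lemma specht_sub_perm : {subset specht_pred <= perm_pred}.
Proof.
move=> h; rewrite /specht_pred unfold_in; case: ifP => _; last first.
  by move=> /eqP ->; case: perm_submod_closed.
move=> /asboolP[b ->]; apply/asboolP.
by exists (T (w_part r lam) * y_elt (conj_part r lam) * b); rewrite !mulrA.
Qed.

Definition perm_module := {h : H | h \in perm_pred}.
HB.instance Definition _ := SubChoice.on perm_module.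
HB.instance Definition _ := [SubChoice_isSubLmodule of perm_module by <:].

Definition specht_module := {h : H | h \in specht_pred}.
HB.instance Definition _ := SubChoice.on specht_module.
HB.instance Definition _ := [SubChoice_isSubLmodule of specht_module by <:].

Definition specht_incl (u : specht_module) : perm_module :=
  Sub (val u) (specht_sub_perm (valP u)).

Lemma specht_incl_linear : linear specht_incl.
Proof. by move=> c u v; apply: val_inj. Qed.

HB.instance Definition _ :=
  GRing.isLinear.Build R specht_module perm_module *:%R specht_incl
    specht_incl_linear.

(* lam is the only chain of length 0 starting at lam, so the degree 0 term is
   the single summand Hom_R(M^lam, R). *)
Definition C_0 := {linear perm_module -> R^o}.
Definition C_minus1 := {linear specht_module -> R^o}.
Definition d_0 (e : C_0) : C_minus1 := e \o specht_incl.

End Modules.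

(* Main.v *)
From HB Require Import structures.
Require Import Defs.
From mathcomp Require Import all_boot all_order all_fingroup all_algebra.
From mathcomp Require Import boolp zify.
Set Implicit Arguments.
Unset Strict Implicit.
Unset Printing Implicit Defensive.
Import GRing.Theory.
Local Open Scope ring_scope.

(** A functional on [S^lam] extends to [M^lam] because [S^lam] has an [R]-basis
    on which some coordinate functionals of the [T]-basis are unitriangular, up
    to units. If [lam] is not a partition, [S^lam = 0] and all is trivial.

    Let [mu] be the conjugate of [lam] and [z = x_lam T_w y_mu] the generator,
    with [w = w_lam]. Number the boxes of the diagram along the columns, and
    read a permutation [d] as the filling that puts [d k] into box [k]; call [d]
    standard if this filling increases along rows and columns.

    Spanning: every [z T_d] is a combination of standard ones, by induction on
    the length of [d] ([standard_span_all]). A descent of [d] within a column is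
    removed by [y_mu T_s = - y_mu]. If two neighbours in a row are out of order,
    their Garnir belt consists of the boxes from the first one to the foot of its
    column and from the head of the next column to the second one. The
    alternating sum over the shortest representatives [e] of the column
    stabilizer in the symmetric group of the belt satisfies [z (sum_e +- q^? T_e)
    = 0]: it completes a right factor of [y_mu] to the alternating sum of the
    belt, which is orthogonal to the row sum [x_lam] by the pigeonhole principle
    ([garnir_relation], [garnir_pigeonhole], [sym_T_alt_eq0]). For columns in
    order, [d] is a product [e0 d'] with [e0] the unique longest of these [e],
    and the relation multiplied by [T_d'] expresses [z T_d] by shorter
    permutations.

    Triangularity: for standard [d] and [d'], the coefficient of [T_(w d')] in
    [z T_d] is a unit for [d = d'] and vanishes otherwise unless [d] is strictly
    smaller than [d'] in the dominance order, which compares the numbers of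
    entries [< m] in the first [j] columns ([coef_z_diag], [coef_z_triangular]).
    The reason is that [T_a T_b] is a unit times [T_(a b)] plus terms [T_(a b')]
    with [b'] shorter than [b] and below it in the Bruhat order, and that [z] is
    the combination of the [T_(v w u)], [v] in the row group and [u] in the
    column group, with unit coefficients. If [v w u b' = w d'] then [u b'] arises
    from the standard [d'] by permuting boxes within rows, which never moves
    more small entries to the left, while passing from [d] to [b'] never moves
    fewer.

    Hence a combination of the coefficient functionals, restricted to [M^lam],
    takes any prescribed values on the standard [z T_d], in particular those of
    a given functional on [S^lam], and agrees with it as these elements span. *)

(** * Length and inversions *)

Section Inversions.
Local Open Scope nat_scope.
Context (r : nat).
Implicit Types (u v w d : 'S_r) (b c : 'I_r -> nat) (i j k : 'I_r).

Definition monotone b := forall k k', k <= k' -> b k <= b k'.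

(** When [b] labels the blocks of a parabolic subgroup [W_b], these [w] are the
    shortest elements of the cosets [W_b w]. *)
Definition increasing_on b w : bool :=
  [forall k : 'I_r, forall k' : 'I_r, (k < k') ==> (b k == b k') ==> (w k < w k')].

Lemma increasing_onP b w :
  reflect (forall k k', k < k' -> b k = b k' -> w k < w k') (increasing_on b w).
Proof.
apply: (iffP forallP) => [h k k' lt eq|h k].
  by have /forallP/(_ k') := h k; rewrite lt eq eqxx.
by apply/forallP => k'; apply/implyP => lt; apply/implyP => /eqP eq; apply: h.
Qed.

Lemma increasing_on_lt b w k k' : increasing_on b w -> b k = b k' ->
  (w k < w k') = (k < k').
Proof.
move=> /increasing_onP h e; case: (ltngtP k k') => [lt|lt|/val_inj ->].
- exact: h.
- by have := h _ _ lt (esym e); case: ltngtP.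
- by rewrite ltnn.
Qed.

(** A descent inside a block can be found at adjacent points, since [b] is
    constant on the whole interval between two points of a block. *)
Lemma descent_ex b w : monotone b -> ~~ increasing_on b w ->
  exists i j, [/\ j = i.+1 :> nat, b i = b j & w j < w i].
Proof.
move=> mb; apply: contraNP => no_desc; apply/increasing_onP => k k' lt.
have [n] := ubnP (k' - k); elim: n k' lt => // n IH k' lt lt_n e.
have lt_p : k'.-1 < r by apply: leq_ltn_trans (ltn_ord k'); rewrite leq_pred.
pose p := Ordinal lt_p.
have pk' : k' = p.+1 :> nat by rewrite /= prednK // (leq_ltn_trans _ lt).
have kp : k <= p by rewrite -ltnS -pk'.
have ep : b p = b k'.
  by apply/eqP; rewrite eqn_leq mb /= ?leq_pred // -e mb.
have wp : w p < w k'.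
  rewrite ltn_neqAle; apply/andP; split.
    by apply/eqP => /val_inj/perm_inj/(congr1 val)/= ?; lia.
  by rewrite leqNgt; apply/negP => lt'; apply: no_desc; exists p, k'.
have [kp'|] := ltnP k p; last first.
  by move=> pk; rewrite (_ : k = p) //; apply/val_inj/eqP; rewrite /= eqn_leq kp.
by apply: ltn_trans wp; apply: IH; rewrite ?e //; lia.
Qed.

Lemma increasing_eq1 w : increasing_on (fun=> 0) w -> w = 1%g.
Proof.
have le_w (v : 'S_r) : increasing_on (fun=> 0) v -> forall n k, n = k :> nat -> k <= v k.
  move=> hv; elim=> [|n IH] k nk; first by rewrite -nk.
  have lt_p : n < r by apply: ltn_trans (ltn_ord k); rewrite -nk.
  have lt_nk : Ordinal lt_p < k by rewrite /= -nk.
  rewrite -nk; apply: leq_ltn_trans (IH (Ordinal lt_p) erefl) _.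
  by rewrite (increasing_on_lt hv).
move=> hw; have hw' : increasing_on (fun=> 0) w^-1%g.
  by apply/increasing_onP => k k' lt _; rewrite -(increasing_on_lt hw) // !permKV.
apply/permP => k; rewrite perm1; apply/val_inj/eqP; rewrite eqn_leq (le_w _ hw _ k erefl) andbT.
by rewrite -[X in _ <= nat_of_ord X](permK w) (le_w _ hw' _ (w k) erefl).
Qed.

Definition inversions w : {set 'I_r * 'I_r} :=
  [set ij : 'I_r * 'I_r | (ij.1 < ij.2) && (w ij.2 < w ij.1)].

Definition inv w := #|inversions w|.

Lemma inv1 : inv 1%g = 0.
Proof.
by apply/eqP; rewrite cards_eq0; apply/eqP/setP => ij; rewrite !inE !perm1; lia.
Qed.

Lemma inv0_eq1 w : inv w = 0 -> w = 1%g.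
Proof.
move=> /eqP; rewrite cards_eq0 => /eqP inv0; apply: increasing_eq1.
apply/increasing_onP => k k' lt _; rewrite ltn_neqAle; apply/andP; split.
  by apply/eqP => /val_inj/perm_inj e; move: lt; rewrite e ltnn.
rewrite leqNgt; apply/negP => lt'.
by have := in_set0 (k, k'); rewrite -inv0 inE /= lt lt'.
Qed.

(** If [d] undoes no inversion of [u], the inversions of [u * d] are those of
    [u], together with the preimages under [u] of those of [d]. *)
Lemma inv_mul u d : (forall k k', k < k' -> u k' < u k -> d (u k') < d (u k)) ->
  inv (u * d)%g = inv u + inv d.
Proof.
move=> h; rewrite /inv -(cardsID (inversions u)); congr (_ + _).
  congr #|pred_of_set _|; apply/setP => -[k k']; rewrite !inE !permM /=.
  case lt: (k < k'); rewrite ?andbF //= andbC.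
  by case lt': (u k' < u k); rewrite //= h.
pose g (ij : 'I_r * 'I_r) := (u ij.1, u ij.2).
have g_inj : injective g by move=> [i j] [i' j'] [/perm_inj -> /perm_inj ->].
rewrite -(card_imset _ g_inj); congr #|pred_of_set _|; apply/setP => -[i j].
rewrite -[i](permKV u) -[j](permKV u); move: (_ i) (_ j) => k k'.
rewrite (mem_imset _ (k, k') g_inj) !inE !permM /=.
have [lt|lt|/val_inj ->] := ltngtP k k'; last by rewrite !ltnn.
- rewrite /= -leqNgt; case: (ltngtP (u k) (u k')) => // /val_inj/perm_inj e.
  by move: lt; rewrite e ltnn.
- rewrite /=; apply/esym/negbTE/negP => /andP[lt1 lt2].
  by have := h _ _ lt lt1; lia.
Qed.

Lemma invV w : inv w^-1%g = inv w.
Proof.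
pose g (ij : 'I_r * 'I_r) := (w ij.2, w ij.1).
have g_inj : injective g by move=> [i j] [i' j'] [/perm_inj -> /perm_inj ->].
rewrite /inv -(card_imset (inversions w) g_inj); congr #|pred_of_set _|.
apply/setP => -[i j]; rewrite -[i](permKV w) -[j](permKV w).
move: (_ i) (_ j) => k k'.
by rewrite (mem_imset _ (k', k) g_inj) !inE !permK /= andbC.
Qed.

Lemma inv_tperm i j : j = i.+1 :> nat -> inv (tperm i j) = 1.
Proof.
move=> ij; apply/eqP/cards1P; exists (i, j); apply/setP => -[k k']; rewrite !inE /=.
rewrite xpair_eqE -!val_eqE /=.
by case: tpermP => [->|->|/eqP + /eqP +]; case: tpermP => [->|->|/eqP + /eqP +];
  rewrite -?val_eqE /=; lia.
Qed.

Lemma inv_mul_tperm w i j : j = i.+1 :> nat ->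
  inv (w * tperm i j)%g =
    if w^-1%g i < w^-1%g j then inv w + 1 else inv w - 1.
Proof.
move=> ij; have up v : v^-1%g i < v^-1%g j -> inv (v * tperm i j)%g = inv v + 1.
  move=> lt; rewrite inv_mul ?inv_tperm // => k k'.
  rewrite -{1}[k](permK v) -{1}[k'](permK v); move: (v k) (v k') => x x' lt1 lt2.
  move: lt1 lt2 lt.
  by case: tpermP => [->|->|/eqP + /eqP +]; case: tpermP => [->|->|/eqP + /eqP +];
    rewrite -?val_eqE /=; lia.
case: ltngtP => [lt|lt|/val_inj/perm_inj e]; first exact: up.
  have := up (w * tperm i j)%g; rewrite -mulgA tperm2 mulg1 => -> //.
    by rewrite addnK.
  by rewrite invMg tpermV !permM tpermL tpermR.
by move: ij; rewrite e => /eqP; lia.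
Qed.

Lemma simple_reflP s :
  reflect (exists i j, j = i.+1 :> nat /\ s = tperm i j) (s \in simple_refl r).
Proof.
apply: (iffP imsetP) => [[[i j]]|[i [j [ij ->]]]].
  by rewrite inE /= => /eqP ij ->; exists i, j.
by exists (i, j); rewrite // inE /= ij.
Qed.

Lemma length_inv w : length w = inv w.
Proof.
rewrite /length; case: ex_minnP => n wn min_n; apply/eqP; rewrite eqn_leq.
apply/andP; split.
  apply: min_n; move e: (inv w) => m.
  elim: m w e {n wn} => [|m IH] w e.
    by rewrite (inv0_eq1 e) expg0 inE.
  have [|i [j [ij _ lt]]] := @descent_ex (fun=> 0) w^-1%g (fun _ _ _ => leqnn _).
    apply/negP => /increasing_eq1/(congr1 inv); rewrite invV e inv1 //.
  rewrite -[w](mulgK (tperm i j)) tpermV expgSr mem_mulg //.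
    by apply: IH; rewrite inv_mul_tperm // ltnNge (ltnW lt) /= e subn1.
  by apply/simple_reflP; exists i, j.
elim: n w wn {min_n} => [|n IH] w; first by rewrite expg0 inE => /eqP->; rewrite inv1.
rewrite expgSr => /mulsgP[v s /IH hv /simple_reflP[i [j [ij ->]]] ->].
by rewrite inv_mul_tperm //; case: ifP; lia.
Qed.

Lemma length1 : length (1%g : 'S_r) = 0.
Proof. by rewrite length_inv inv1. Qed.

Lemma length_eq0 w : length w = 0 -> w = 1%g.
Proof. by rewrite length_inv => /inv0_eq1. Qed.

Lemma lengthV w : length w^-1%g = length w.
Proof. by rewrite !length_inv invV. Qed.

Lemma length_tperm i j : j = i.+1 :> nat -> length (tperm i j) = 1.
Proof. by move=> ij; rewrite length_inv inv_tperm. Qed.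

Lemma length_mul u d : (forall k k', k < k' -> u k' < u k -> d (u k') < d (u k)) ->
  length (u * d)%g = length u + length d.
Proof. by move=> h; rewrite !length_inv inv_mul. Qed.

Lemma length_mul_up w i j : j = i.+1 :> nat -> w^-1%g i < w^-1%g j ->
  length (w * tperm i j)%g = length w + 1.
Proof. by move=> ij lt; rewrite !length_inv inv_mul_tperm // lt. Qed.

Lemma length_mul_down w i j : j = i.+1 :> nat -> w^-1%g j < w^-1%g i ->
  length w = length (w * tperm i j)%g + 1.
Proof.
move=> ij lt; have := @length_mul_up (w * tperm i j)%g i j ij.
rewrite -mulgA tperm2 mulg1 => -> //.
by rewrite invMg tpermV !permM tpermL tpermR.
Qed.

Lemma right_descent w : w != 1%g -> exists i j,
  [/\ j = i.+1 :> nat, w^-1%g j < w^-1%g i & length w = length (w * tperm i j)%g + 1].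
Proof.
move=> w1; have [|i [j [ij _ lt]]] := @descent_ex (fun=> 0) w^-1%g (fun _ _ _ => leqnn _).
  by apply: contraNN w1 => /increasing_eq1/eqP; rewrite invg_eq1.
by exists i, j; split=> //; apply: length_mul_down.
Qed.

Lemma left_descent w i j : j = i.+1 :> nat -> w j < w i ->
  length w = length (tperm i j * w)%g + 1.
Proof.
move=> ij lt; rewrite -[in LHS]lengthV -[in RHS]lengthV invMg tpermV.
by apply: length_mul_down; rewrite ?invgK.
Qed.

(** The inclusion of inversion sets is strict, because [v] and [w] order all
    pairs alike only if [v^-1 * w] is increasing. *)
Lemma length_lt_sub v w : inversions v \subset inversions w -> v != w ->
  length v < length w.
Proof.
move=> sub neq; rewrite !length_inv /inv; apply: proper_card; rewrite properEneq sub.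
rewrite andbT; apply: contraNN neq => /eqP e; rewrite eq_mulVg1; apply/eqP.
apply: increasing_eq1; apply/increasing_onP => k k' lt _.
rewrite !permM; move: lt; rewrite -{1}[k](permKV v) -{1}[k'](permKV v).
move: (_ k) (_ k') => x x'; move/setP: e => e lt.
case: (ltngtP x x') => [lx|lx|/val_inj ex]; last by rewrite ex ltnn in lt.
  have := e (x, x'); rewrite !inE /= lx [v x' < _]ltnNge (ltnW lt) /=.
  by move/esym/negbT; rewrite -leqNgt leq_eqVlt => /orP[/eqP/val_inj/perm_inj ex|//];
    rewrite ex ltnn in lx.
by have := e (x', x); rewrite !inE /= lx lt => /esym.
Qed.

End Inversions.

(** * Counts and the Bruhat order *)

Section Domination.
Local Open Scope nat_scope.
Context (r : nat).
Implicit Types (u v w : 'S_r) (i j k : 'I_r).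

Lemma length_mul_tperm_le w i j : j = i.+1 :> nat ->
  length (w * tperm i j)%g <= length w + 1.
Proof. by move=> ij; rewrite !length_inv inv_mul_tperm //; case: ifP; lia. Qed.

Lemma length_mul_le u v : length (u * v)%g <= length u + length v.
Proof.
have [n] := ubnP (length v); elim: n v => // n IH v lt_n.
have [->|/right_descent[i [j [ij _ lv]]]] := eqVneq v 1%g; first by rewrite mulg1 leq_addr.
have lt_v : length (v * tperm i j)%g < n by lia.
have := @length_mul_tperm_le (u * (v * tperm i j)) i j ij.
rewrite -!mulgA tperm2 mulg1 => /leq_trans-> //.
by rewrite lv addnA leq_add2r IH.
Qed.

(** The rank function of the permutation matrix of [w]. *)
Definition cnt w (x m : nat) : nat := #|[set k : 'I_r | (k < x) && (w k < m)]|.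

Lemma cntS w x k : cnt w x k.+1 = cnt w x k + (w^-1%g k < x).
Proof.
rewrite /cnt (cardsD1 (w^-1%g k)) inE permKV ltnSn andbT addnC; congr (_ + _).
congr #|pred_of_set _|; apply/setP => k'; rewrite !inE.
rewrite -(inj_eq (@perm_inj _ w)) permKV -val_eqE /=; lia.
Qed.

Lemma cnt_tperm w i j x m : j = i.+1 :> nat ->
  cnt (w * tperm i j)%g x m =
    if m == j then cnt w x i + (w^-1%g j < x) else cnt w x m.
Proof.
move=> ij; have neq (m' : nat) : m' != j -> cnt (w * tperm i j)%g x m' = cnt w x m'.
  move=> mj; congr #|pred_of_set _|; apply/setP => k; rewrite !inE permM; congr andb.
  by case: tpermP => [->|->|_ _]; lia.
case: eqP => [->|/eqP/neq //].
by rewrite ij cntS neq ?ij ?neq_ltn ?ltnSn // invMg tpermV permM tpermL.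
Qed.

(** The comparison of counts is the Bruhat order in its tableau form. *)
Definition below v w : Prop :=
  ((v == w) || (length v < length w)) /\ forall x m, cnt w x m <= cnt v x m.

Lemma below_refl w : below w w.
Proof. by split; rewrite ?eqxx. Qed.

(** Appending a letter to a reduced word of [w] keeps both kinds of subwords,
    with the letter applied or dropped, below the word. *)
Lemma below_step v w i j : j = i.+1 :> nat -> w^-1%g i < w^-1%g j -> below v w ->
  below v (w * tperm i j)%g /\ below (v * tperm i j)%g (w * tperm i j)%g.
Proof.
move=> ij lt [hl hN]; have lw := length_mul_up ij lt.
have lv : length v <= length w by case/orP: hl => [/eqP->|/ltnW].
have dom x m : cnt (w * tperm i j)%g x m <= cnt w x m.
  rewrite cnt_tperm //; case: eqP => // ->; rewrite ij cntS leq_add2l; lia.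
split; split=> [|x m].
- by rewrite lw; lia.
- exact: leq_trans (dom x m) (hN x m).
- case/orP: hl => [/eqP->|hl]; first by rewrite eqxx.
  by have := length_mul_tperm_le v ij; lia.
rewrite [X in _ <= X]cnt_tperm //; case: eqP => [->|_]; last first.
  exact: leq_trans (dom x m) (hN x m).
rewrite cnt_tperm // eqxx.
have e u : cnt u x j.+1 = cnt u x i + (u^-1%g i < x) + (u^-1%g j < x).
  by rewrite cntS ij cntS.
have := hN x i; have := hN x j.+1; rewrite !e; lia.
Qed.

End Domination.

(** * Coefficients in the Hecke algebra *)

Section Hecke.
Local Open Scope ring_scope.
Context (R : idomainType) (q : R) (r : nat) (H : algType R) (T : 'S_r -> H).
Context (hecke_H : is_hecke_algebra q T).
Implicit Types (u v w a b c : 'S_r) (i j k : 'I_r) (h : H).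

Definition coords h : {ffun 'S_r -> R} := sval (cid (hecke_basis hecke_H h)).

Lemma coordsE h : h = \sum_w coords h w *: T w.
Proof. by rewrite /coords; case: cid => c [/= <-]. Qed.

Lemma coords_uniq h (c : 'S_r -> R) : h = \sum_w c w *: T w -> coords h =1 c.
Proof.
rewrite /coords; case: cid => /= c' [_ uniq_c'] e.
rewrite (uniq_c' (finfun c)); first by move=> w; rewrite ffunE.
by rewrite e; apply: eq_bigr => w _; rewrite ffunE.
Qed.

Definition coef w h : R^o := coords h w.

Lemma coef_is_linear w : linear (coef w).
Proof.
move=> x h h'; apply: (coords_uniq (c := fun w => x * coords h w + coords h' w)).
rewrite {1}(coordsE h) {1}(coordsE h') scaler_sumr -big_split /=.
by apply: eq_bigr => v _; rewrite scalerDl scalerA.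
Qed.

HB.instance Definition _ w :=
  GRing.isLinear.Build R H R^o *:%R (coef w) (coef_is_linear w).

Lemma coefT w v : coef w (T v) = (v == w)%:R.
Proof.
apply: (coords_uniq (c := fun w => (v == w)%:R)).
rewrite (bigD1 v) //= eqxx scale1r big1 ?addr0 // => w' /negbTE neq.
by rewrite eq_sym neq scale0r.
Qed.

Lemma T_mul_tperm w i j : j = i.+1 :> nat ->
  T w * T (tperm i j) = if (w^-1%g i < w^-1%g j)%N then T (w * tperm i j)%g
    else q *: T (w * tperm i j)%g + (q - 1) *: T w.
Proof.
move=> ij; have sS : tperm i j \in simple_refl r by apply/simple_reflP; exists i, j.
case: ltngtP => [lt|lt|/val_inj/perm_inj e].
- by rewrite (hecke_mul_up hecke_H) ?length_mul_up.
- by rewrite (hecke_mul_down hecke_H) //; apply: length_mul_down.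
- by move: ij; rewrite e; lia.
Qed.

Lemma T_mul u v : length (u * v)%g = (length u + length v)%N ->
  T u * T v = T (u * v)%g.
Proof.
have [n] := ubnP (length v); elim: n v => // n IH v lt_n.
have [->|/right_descent[i [j [ij desc lv]]]] := eqVneq v 1%g.
  by rewrite (hecke_one hecke_H) mulr1 mulg1.
set v' := (v * tperm i j)%g in lv; have -> : v = (v' * tperm i j)%g.
  by rewrite -mulgA tperm2 mulg1.
rewrite mulgA => luv.
have sS : tperm i j \in simple_refl r by apply/simple_reflP; exists i, j.
have lv' : length (v' * tperm i j)%g = (length v' + 1)%N by rewrite -mulgA tperm2 mulg1.
have l1 := length_mul_tperm_le (u * v') ij; have l2 := length_mul_le u v'.
rewrite lv' in luv.
have luv' : length (u * v')%g = (length u + length v')%N.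
  by apply/eqP; rewrite eqn_leq l2 -(leq_add2r 1) -addnA -luv.
rewrite -(hecke_mul_up hecke_H) // mulrA IH //; last by move: lt_n; rewrite lv addn1 ltnS.
by rewrite (hecke_mul_up hecke_H) // luv luv' addnA.
Qed.

Lemma T_quadratic i j : j = i.+1 :> nat ->
  T (tperm i j) * T (tperm i j) = q *: 1 + (q - 1) *: T (tperm i j).
Proof.
move=> ij; rewrite T_mul_tperm // tpermV tpermL tpermR ij ltnNge leqnSn /=.
by rewrite tperm2 (hecke_one hecke_H).
Qed.

Lemma coef_mul_tperm c h i j : j = i.+1 :> nat ->
  coef c (h * T (tperm i j)) =
    if (c^-1%g i < c^-1%g j)%N then q * coef (c * tperm i j)%g h
    else coef (c * tperm i j)%g h + (q - 1) * coef c h.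
Proof.
move=> ij; pose s := tperm i j.
have basis w : coef c (T w * T s) =
    if (c^-1%g i < c^-1%g j)%N then q * (w == c * s)%g%:R
    else (w == c * s)%g%:R + (q - 1) * (w == c)%:R.
  have ws : (w * s == c)%g = (w == c * s)%g.
    by apply/eqP/eqP => [<-|->]; rewrite -mulgA tperm2 mulg1.
  have cs : (c * s == c)%g = false.
    apply/negP => /eqP/(congr1 (mulg c^-1)); rewrite mulKg mulVg => /permP/(_ i).
    by rewrite tpermL perm1 => e; move: ij; rewrite e; lia.
  rewrite T_mul_tperm // -/s.
  have [->|neq] := eqVneq w (c * s)%g.
    rewrite cs invMg tpermV !permM tpermL tpermR -mulgA tperm2 mulg1 mulr1 mulr0 addr0.
    case: ltngtP => [lt|lt|/val_inj/perm_inj e]; last by move: ij; rewrite e; lia.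
      by rewrite coefT eqxx.
    rewrite linearP /= linearZ /= !coefT eqxx cs.
    by rewrite /GRing.scale /= mulr1 mulr0 addr0.
  rewrite mulr0 add0r; have [->|neq'] := eqVneq w c.
    case: ifP => _; first by rewrite coefT cs.
    by rewrite linearP /= linearZ /= !coefT cs eqxx /GRing.scale /= mulr0 add0r.
  rewrite mulr0; case: ifP => _; first by rewrite coefT ws (negbTE neq) if_same.
  rewrite linearP /= linearZ /= !coefT ws (negbTE neq) (negbTE neq') if_same.
  by rewrite /GRing.scale /= !mulr0 addr0.
rewrite [in LHS](coordsE h) mulr_suml linear_sum /=.
have expand x : coef x h = \sum_w coef w h * (w == x)%:R.
  rewrite [in LHS](coordsE h) linear_sum; apply: eq_bigr => w _.
  by rewrite linearZ /= coefT.
transitivity (\sum_w coef w h * coef c (T w * T s)).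
  by apply: eq_bigr => w _; rewrite -scalerAl linearZ.
rewrite !expand; case: ifP => lt.
  rewrite mulr_sumr; apply: eq_bigr => w _; by rewrite basis lt mulrCA.
rewrite mulr_sumr -big_split; apply: eq_bigr => w _ /=.
by rewrite basis lt mulrDr [in RHS]mulrCA.
Qed.

(** Each letter of a reduced word of [b] is either applied or dropped, so the
    support of [T a * T b] lies in the products of [a] with subwords of [b]. *)
Lemma coef_mul_below a b b' : coef (a * b')%g (T a * T b) != 0 -> below b' b.
Proof.
have [n] := ubnP (length b); elim: n b b' => // n IH b b' lt_n.
have [->|/right_descent[i [j [ij desc lb]]]] := eqVneq b 1%g.
  have [-> _|ne] := eqVneq b' 1%g; first exact: below_refl.
  rewrite (hecke_one hecke_H) mulr1 coefT -{1}[a]mulg1 (inj_eq (mulgI a)) [1%g == _]eq_sym.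
  by rewrite (negbTE ne) eqxx.
set b1 := (b * tperm i j)%g in lb; have eb : b = (b1 * tperm i j)%g.
  by rewrite -mulgA tperm2 mulg1.
have asc : (b1^-1%g i < b1^-1%g j)%N.
  by rewrite invMg tpermV !permM tpermL tpermR.
have lt_b1 : (length b1 < n)%N by move: lt_n; rewrite lb addn1 ltnS.
have -> : T b = T b1 * T (tperm i j) by rewrite T_mul_tperm // asc -eb.
have step v : coef (a * v)%g (T a * T b1) != 0 -> below v b /\ below (v * tperm i j)%g b.
  by move=> /(IH _ _ lt_b1) hv; rewrite eb; apply: below_step.
have undo : (b' = b' * tperm i j * tperm i j)%g by rewrite -mulgA tperm2 mulg1.
rewrite mulrA coef_mul_tperm // -[(a * b' * _)%g]mulgA; case: ifP => _ nz.
  rewrite undo; apply: (step _ _).2; apply: contraNneq nz => ->; by rewrite mulr0.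
have [e|/step[]//] := eqVneq (coef (a * b')%g (T a * T b1)) 0.
rewrite undo; apply: (step _ _).2; apply: contraNneq nz => ->.
by rewrite e mulr0 addr0.
Qed.

Context (q_unit : q \is a GRing.unit).

(** The term [T (a * b)] arises only by applying all letters of a reduced word
    of [b], each contributing the factor 1 or [q]. *)
Lemma coef_mul_lead a b : coef (a * b)%g (T a * T b) \is a GRing.unit.
Proof.
have [n] := ubnP (length b); elim: n b => // n IH b lt_n.
have [->|/right_descent[i [j [ij desc lb]]]] := eqVneq b 1%g.
  by rewrite (hecke_one hecke_H) mulr1 mulg1 coefT eqxx unitr1.
set b1 := (b * tperm i j)%g in lb; have eb : b = (b1 * tperm i j)%g.
  by rewrite -mulgA tperm2 mulg1.
have asc : (b1^-1%g i < b1^-1%g j)%N.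
  by rewrite invMg tpermV !permM tpermL tpermR.
have lt_b1 : (length b1 < n)%N by move: lt_n; rewrite lb addn1 ltnS.
have -> : T b = T b1 * T (tperm i j) by rewrite T_mul_tperm // asc -eb.
rewrite mulrA coef_mul_tperm // -[(a * b * _)%g]mulgA -/b1.
case: ifP => _; first by rewrite unitrM q_unit IH.
suff -> : coef (a * b)%g (T a * T b1) = 0 by rewrite mulr0 addr0 IH.
apply/eqP/negP => /negP/coef_mul_below[/orP[/eqP e|]]; last by rewrite lb; lia.
by move: lb; rewrite -e; lia.
Qed.

End Hecke.

(** * Parabolic subgroups and their sums *)

Section YoungSubgroups.
Local Open Scope nat_scope.
Context (r : nat).
Implicit Types (u v w d : 'S_r) (b : 'I_r -> nat) (i j k : 'I_r).

(** A parabolic subgroup is given by a monotone label of the points, whose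
    fibres are its blocks. *)
Definition young b : {set 'S_r} := [set w : 'S_r | [forall k : 'I_r, b (w k) == b k]].

Lemma youngP b w : reflect (forall k, b (w k) = b k) (w \in young b).
Proof.
rewrite inE; apply: (iffP forallP) => h k; first exact/eqP.
by rewrite h.
Qed.

Lemma young1 b : 1%g \in young b.
Proof. by apply/youngP => k; rewrite perm1. Qed.

Lemma youngM b v w : v \in young b -> w \in young b -> (v * w)%g \in young b.
Proof. by move=> /youngP hv /youngP hw; apply/youngP => k; rewrite permM hw hv. Qed.

Lemma youngV b w : (w^-1%g \in young b) = (w \in young b).
Proof.
apply/youngP/youngP => h k; first by rewrite -(h (w k)) permK.
by rewrite -(h (w^-1%g k)) permKV.
Qed.

Lemma young_tperm b i j : b i = b j -> tperm i j \in young b.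
Proof. by move=> e; apply/youngP => k; case: tpermP => [->|->|]. Qed.

Lemma young_finer b b' : (forall k k', b' k = b' k' -> b k = b k') ->
  {subset young b' <= young b}.
Proof. by move=> h w /youngP hw; apply/youngP => k; apply: h. Qed.

Lemma young_length_mul b u d : monotone b -> u \in young b -> increasing_on b d ->
  length (u * d)%g = length u + length d.
Proof.
move=> mb /youngP hu /increasing_onP hd; apply: length_mul => k k' lt lt'.
have := mb _ _ (ltnW lt); have := mb _ _ (ltnW lt'); rewrite !hu => le1 le2.
by apply: hd => //; rewrite !hu; apply/eqP; rewrite eqn_leq le1.
Qed.

Lemma young_length_mulV b u d : monotone b -> u \in young b -> increasing_on b d^-1%g ->
  length (d * u)%g = length d + length u.
Proof.
move=> mb hu hd; rewrite -lengthV invMg (young_length_mul mb) ?youngV //.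
by rewrite !lengthV addnC.
Qed.

Lemma young_coset_min b w : monotone b ->
  exists2 u, u \in young b & increasing_on b (u * w)%g.
Proof.
move=> mb; have [n] := ubnP (length w); elim: n w => // n IH w lt_n.
have [hw|/(descent_ex mb)[i [j [ij e lt]]]] := boolP (increasing_on b w).
  by exists 1%g; rewrite ?young1 ?mul1g.
have lw := left_descent ij lt.
have [|u hu hw] := IH (tperm i j * w)%g; first by rewrite lw addn1 in lt_n.
by exists (u * tperm i j)%g; rewrite -?mulgA // youngM ?young_tperm.
Qed.

Lemma young_coset_uniq b u d d' : monotone b -> u \in young b ->
  increasing_on b d -> increasing_on b d' -> (u * d)%g = d' -> u = 1%g.
Proof.
move=> mb hu hd hd' e; apply: length_eq0.
have := young_length_mul mb hu hd; rewrite e.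
have := young_length_mul mb (_ : u^-1%g \in young b) hd'; rewrite youngV => /(_ hu).
by rewrite -[X in length (_ * X)%g]e mulKg lengthV; lia.
Qed.

End YoungSubgroups.

Section ParabolicSums.
Local Open Scope ring_scope.
Context (R : idomainType) (q : R) (r : nat) (H : algType R) (T : 'S_r -> H).
Context (hecke_H : is_hecke_algebra q T).
Implicit Types (u v w d : 'S_r) (b : 'I_r -> nat) (i j k : 'I_r) (x : R).

(** Both kinds of parabolic sums are instances: the row sums with [x = 1], the
    alternating column sums with [x = (- q)^-1]. *)
Definition psum b x : H := \sum_(w in young b) x ^+ length w *: T w.

(** Each element of the larger group is uniquely [u * d] with [u] in the smaller
    group and [d] shortest in its coset, and lengths add. *)
Lemma psum_factor_left b b' x : monotone b' ->
    (forall k k', b' k = b' k' -> b k = b k') ->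
  psum b x = psum b' x *
    \sum_(d in young b | increasing_on b' d) x ^+ length d *: T d.
Proof.
move=> mb' fine; pose D := [set d in young b | increasing_on b' d].
have -> : \sum_(d in young b | increasing_on b' d) x ^+ length d *: T d =
    \sum_(d in D) x ^+ length d *: T d by apply: eq_bigl => d; rewrite [in RHS]inE.
pose f (p : 'S_r * 'S_r) := (p.1 * p.2)%g.
have f_inj : {in setX (young b') D &, injective f}.
  move=> [u d] [u' d'] /setXP[/= hu]; rewrite inE => /andP[_ hd] /setXP[/= hu'].
  rewrite inE => /andP[_ hd']; rewrite /f /= => e.
  have e' : (u'^-1 * u * d)%g = d' by rewrite -mulgA e mulKg.
  have := young_coset_uniq mb' _ hd hd' e'; rewrite youngM ?youngV // => /(_ isT) e1.
  by rewrite -e' e1 mul1g; congr (_, _); apply/eqP; rewrite eq_sym eq_mulVg1 e1.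
have -> : psum b x = \sum_(w in f @: setX (young b') D) x ^+ length w *: T w.
  rewrite /psum; apply: eq_bigl => w; apply/idP/imsetP => [hw|[[u d] /setXP[/= hu]]]; last first.
    by rewrite inE => /andP[hd _] ->; rewrite youngM // (young_finer fine).
  have [u hu hd] := young_coset_min w mb'; exists (u^-1, u * w)%g.
    by rewrite inE /= youngV hu inE hd youngM // (young_finer fine).
  by rewrite /f /= mulKg.
rewrite (big_imset _ f_inj) big_distrlr /= pair_big_dep /=.
apply: eq_big => [[u d]|[u d]]; first by rewrite !inE.
move=> /setXP[/= hu]; rewrite inE => /andP[_ hd].
have l := young_length_mul mb' hu hd.
by rewrite /f /= l -(T_mul hecke_H l) -scalerAl -scalerAr scalerA exprD.
Qed.

End ParabolicSums.

(** * Orthogonality of symmetric and alternating sums *)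

Section Vanishing.
Local Open Scope ring_scope.
Context (R : idomainType) (q : R) (r : nat) (H : algType R) (T : 'S_r -> H).
Context (hecke_H : is_hecke_algebra q T) (q_unit : q \is a GRing.unit).
Implicit Types (u v w d g : 'S_r) (b c : 'I_r -> nat) (i j k : 'I_r) (x : R).

Lemma psum_factor_right b b' x : monotone b' ->
    (forall k k', b' k = b' k' -> b k = b k') ->
  psum T b x = (\sum_(d in young b | increasing_on b' d^-1%g) x ^+ length d *: T d) *
    psum T b' x.
Proof.
move=> mb' fine; pose D := [set d in young b | increasing_on b' d^-1%g].
have -> : \sum_(d in young b | increasing_on b' d^-1%g) x ^+ length d *: T d =
    \sum_(d in D) x ^+ length d *: T d by apply: eq_bigl => d; rewrite [in RHS]inE.
pose f (p : 'S_r * 'S_r) := (p.1 * p.2)%g.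
have f_inj : {in setX D (young b') &, injective f}.
  move=> [d u] [d' u'] /setXP[/=]; rewrite inE => /andP[_ hd] hu /setXP[/=].
  rewrite inE => /andP[_ hd'] hu'; rewrite /f /= => e.
  have e' : (u' * u^-1 * d^-1)%g = d'^-1%g.
    by rewrite -mulgA -invMg e invMg mulgA mulgV mul1g.
  have := young_coset_uniq mb' _ hd hd' e'; rewrite youngM ?youngV // => /(_ isT) e1.
  have {e1} eu : u' = u by rewrite -(mulgKV u u') e1 mul1g.
  by rewrite eu in e *; rewrite (mulIg _ _ _ e).
have -> : psum T b x = \sum_(w in f @: setX D (young b')) x ^+ length w *: T w.
  rewrite /psum; apply: eq_bigl => w; apply/idP/imsetP => [hw|[[d u] /setXP[/=]]]; last first.
    by rewrite inE => /andP[hd _] hu ->; rewrite youngM // (young_finer fine).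
  have [u hu hd] := young_coset_min w^-1%g mb'; exists (w * u^-1, u)%g.
    rewrite inE /= hu inE invMg invgK hd youngM //.
    by rewrite (young_finer fine) ?youngV.
  by rewrite /f /= mulgKV.
rewrite (big_imset _ f_inj) big_distrlr /= pair_big_dep /=.
apply: eq_big => [[d u]|[d u]]; first by rewrite !inE.
move=> /setXP[/=]; rewrite inE => /andP[_ hd] hu.
have l := young_length_mulV mb' hu hd.
by rewrite /f /= l -(T_mul hecke_H l) -scalerAl -scalerAr scalerA exprD.
Qed.

(** A label whose only block with two points is [{i, i + 1}]. *)
Definition pair_label i : 'I_r -> nat := fun k => (k - (i < k))%N.

Lemma pair_label_monotone i : monotone (pair_label i).
Proof. by move=> k k'; rewrite /pair_label; lia. Qed.

Lemma pair_label_eq i j k k' : j = i.+1 :> nat -> k != k' ->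
  pair_label i k = pair_label i k' -> (k = i /\ k' = j) \/ (k = j /\ k' = i).
Proof.
rewrite /pair_label => ij neq e; have neq' : (k != k' :> nat) by [].
have [[/val_inj-> /val_inj->]|[/val_inj-> /val_inj->]] :
  (k = i :> nat /\ k' = j :> nat) \/ (k = j :> nat /\ k' = i :> nat) by lia.
- by left.
- by right.
Qed.

Lemma pair_label_finer b i j k k' : j = i.+1 :> nat -> b i = b j ->
  pair_label i k = pair_label i k' -> b k = b k'.
Proof.
move=> ij e e'; have [->//|neq] := eqVneq k k'.
by case: (pair_label_eq ij neq e') => -[-> ->].
Qed.

Lemma young_pair_label i j : j = i.+1 :> nat ->
  young (pair_label i) = [set 1%g; tperm i j].
Proof.
move=> ij; have ne : i != j by rewrite -val_eqE /= ij; lia.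
apply/setP => w; rewrite in_set2; apply/idP/orP => [/youngP hw|[/eqP->|/eqP->]].
- have move_to k : w k != k -> (w k = i /\ k = j) \/ (w k = j /\ k = i).
    by move=> neq; apply: pair_label_eq ij neq (hw k).
  have [wi|/move_to wi] := eqVneq (w i) i; [left|right]; apply/eqP/permP => k.
    rewrite perm1; apply/eqP/negPn/negP => neq.
    case: (move_to k neq) => -[wk ek]; last by rewrite ek wi eqxx in neq.
    by move: wk; rewrite -[X in _ = X]wi => /perm_inj e; rewrite e wi eqxx in neq.
  have {}wi : w i = j by case: wi => -[// _ eij]; rewrite -eij eqxx in ne.
  case: tpermP => [->//|->|/eqP ki /eqP kj].
    have /move_to[[]//|[_ eij]] : w j != j.
      by apply: contraNneq ne; rewrite -[X in _ = X]wi => /perm_inj->.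
    by rewrite eij eqxx in ne.
  apply/eqP/negPn/negP => /move_to[[_ ek]|[_ ek]].
    by rewrite ek eqxx in kj.
  by rewrite ek eqxx in ki.
- exact: young1.
- by apply: young_tperm; rewrite /pair_label ij; lia.
Qed.

Lemma psum_pair i j x : j = i.+1 :> nat ->
  psum T (pair_label i) x = 1 + x *: T (tperm i j).
Proof.
move=> ij; have ne : 1%g != tperm i j :> 'S_r.
  by apply: contra_eq_neq (length_tperm ij) => <-; rewrite length1.
rewrite /psum (young_pair_label ij) big_setU1 ?inE //= big_set1.
by rewrite length1 length_tperm // expr0 expr1 scale1r (hecke_one hecke_H).
Qed.

Section SimpleReflection.

Context (i j : 'I_r) (ij : j = i.+1 :> nat).
Let s := tperm i j.

Lemma sum_left_factor b x : b i = b j -> exists h, psum T b x = (1 + x *: T s) * h.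
Proof.
move=> e; rewrite (psum_factor_left hecke_H (b' := pair_label i)).
- by rewrite (psum_pair _ ij); eexists.
- exact: pair_label_monotone.
- by move=> k k'; apply: pair_label_finer ij e.
Qed.

Lemma sum_right_factor b x : b i = b j -> exists h, psum T b x = h * (1 + x *: T s).
Proof.
move=> e; rewrite (psum_factor_right (b' := pair_label i)).
- by rewrite (psum_pair _ ij); eexists.
- exact: pair_label_monotone.
- by move=> k k'; apply: pair_label_finer ij e.
Qed.

Lemma sym_mul_T b : b i = b j -> psum T b 1 * T s = q *: psum T b 1.
Proof.
move=> /(sum_right_factor 1)[h ->]; rewrite -mulrA scale1r mulrDl mul1r.
rewrite (T_quadratic hecke_H ij) scalerAr; congr (h * _).
by rewrite addrCA scalerDr scalerBl scale1r [T s + _]addrC subrK.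
Qed.

Lemma alt_mul_T b : b i = b j -> psum T b (- q)^-1 * T s = - psum T b (- q)^-1.
Proof.
move=> /(sum_right_factor (- q)^-1)[h ->]; rewrite -mulrA -mulrN; congr (h * _).
rewrite mulrDl mul1r -scalerAl (T_quadratic hecke_H ij) scalerDr !scalerA opprD.
have -> : (- q)^-1 * q = -1 by rewrite invrN mulNr mulVr.
have -> : (- q)^-1 * (q - 1) = -1 - (- q)^-1.
  by rewrite mulrDr mulrN1 invrN mulNr mulVr.
by rewrite scalerBl !scaleN1r addrCA addNKr.
Qed.

Lemma T_mul_alt b : b i = b j -> T s * psum T b (- q)^-1 = - psum T b (- q)^-1.
Proof.
move=> /(sum_left_factor (- q)^-1)[h ->]; rewrite mulrA -mulNr; congr (_ * h).
rewrite mulrDr mulr1 -scalerAr (T_quadratic hecke_H ij) scalerDr !scalerA opprD.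
have -> : (- q)^-1 * q = -1 by rewrite invrN mulNr mulVr.
have -> : (- q)^-1 * (q - 1) = -1 - (- q)^-1.
  by rewrite mulrDr mulrN1 invrN mulNr mulVr.
by rewrite scalerBl !scaleN1r addrCA addNKr.
Qed.

(** Unlike the comparison of the eigenvalues [q] and [-1] of [T s], this also
    applies when [q = -1]. *)
Lemma sym_alt_orthogonal : (1 + T s) * (1 + (- q)^-1 *: T s) = 0.
Proof.
rewrite mulrDl mul1r mulrDr mulr1 -scalerAr (T_quadratic hecke_H ij).
rewrite scalerDr !scalerA.
have -> : (- q)^-1 * q = -1 by rewrite invrN mulNr mulVr.
have -> : (- q)^-1 * (q - 1) = -1 - (- q)^-1.
  by rewrite mulrDr mulrN1 invrN mulNr mulVr.
rewrite scalerBl !scaleN1r [T s + _]addrCA addNKr addrACA subrr add0r.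
by rewrite subrr.
Qed.

End SimpleReflection.

(** Reducing [g] by descents inside the blocks on both sides only multiplies
    the product by a unit and keeps the existence of a pair [k], [k'] as stated.
    For a reduced [g] the lower point of the pair and its successor form such a
    pair, and their images are adjacent too; so [T s * T g = T g * T t] for two
    simple reflections [s] and [t], and [sym_alt_orthogonal] applies. *)
Lemma sym_T_alt_eq0 b c g k k' : monotone b -> monotone c ->
    k != k' -> b k = b k' -> c (g k) = c (g k') ->
  psum T b 1 * T g * psum T c (- q)^-1 = 0.
Proof.
move=> mb mc; have [n] := ubnP (length g); elim: n g k k' => // n IH g k k' lt_n neq ebk ecg.
have [inc_b|/(descent_ex mb)[i [j [ij e lt]]]] := boolP (increasing_on b g); last first.
  have lg := left_descent ij lt.
  have -> : T g = T (tperm i j) * T (tperm i j * g)%g.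
    by rewrite (T_mul hecke_H) mulgA tperm2 mul1g // length_tperm // lg addnC.
  rewrite mulrA (sym_mul_T ij e) -!scalerAl.
  rewrite (IH _ (tperm i j k) (tperm i j k')) ?scaler0 ?(inj_eq perm_inj) //.
  - by move: lt_n; rewrite lg addn1.
  - by have /youngP fb := young_tperm e; rewrite !fb.
  - by rewrite !permM !tpermK.
have [inc_c|/(descent_ex mc)[i [j [ij e lt]]]] := boolP (increasing_on c g^-1%g); last first.
  have lg := length_mul_down ij lt.
  have -> : T g = T (g * tperm i j)%g * T (tperm i j).
    by rewrite (T_mul hecke_H) -mulgA tperm2 mulg1 // length_tperm.
  rewrite -!mulrA (T_mul_alt ij e) !mulrN mulrA (IH _ k k') ?oppr0 //.
    by move: lt_n; rewrite lg addn1.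
  by have /youngP fc := young_tperm e; rewrite !permM !fc.
wlog lt_k : k k' neq ebk ecg / (k < k')%N.
  move=> wlt; case: (ltngtP k k') => [|lt|/val_inj e]; first exact: wlt.
    by apply: (wlt k' k); rewrite // eq_sym.
  by rewrite e eqxx in neq.
have lt_p : (k.+1 < r)%N by apply: leq_ltn_trans (ltn_ord k').
pose p := Ordinal lt_p; have kp : p = k.+1 :> nat by [].
have ebp : b k = b p.
  by apply/eqP; rewrite eqn_leq mb ?leqnSn // ebk mb.
have lt_g : (g k < g p)%N by rewrite (increasing_on_lt inc_b) ?kp.
have le_g : (g p <= g k')%N.
  by rewrite leqNgt (increasing_on_lt inc_b) -?ebk // -leqNgt.
have ecp : c (g k) = c (g p).
  have le1 : (c (g k) <= c (g p))%N by apply: mc; apply: ltnW.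
  have le2 : (c (g p) <= c (g k'))%N by apply: mc.
  by apply/eqP; rewrite eqn_leq le1 ecg.
have gp : g p = (g k).+1 :> nat.
  apply/eqP; rewrite eqn_leq lt_g andbT leqNgt; apply/negP => lt_m.
  have lt_mr : ((g k).+1 < r)%N by apply: ltn_trans (ltn_ord (g p)).
  pose m := Ordinal lt_mr.
  have ecm : c (g k) = c m.
    have le1 : (c (g k) <= c m)%N by apply: mc; apply: leqnSn.
    have le2 : (c m <= c (g p))%N by apply: mc; apply: ltnW.
    by apply/eqP; rewrite eqn_leq le1 ecp.
  have := increasing_on_lt inc_c (k := g k) (k' := m) ecm.
  have := increasing_on_lt inc_c (k := m) (k' := g p) (etrans (esym ecm) ecp).
  by rewrite !permK lt_m ltnSn kp ltnS; case: ltngtP.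
have [h ->] := sum_right_factor kp 1 ebp.
have [h' ->] := sum_left_factor gp (- q)^-1 ecp.
have commute : (tperm k p * g = g * tperm (g k) (g p))%g.
  by rewrite -[tperm (g k) _]tpermJ conjgE !mulgA mulgV mul1g.
have Tcommute : T (tperm k p) * T g = T g * T (tperm (g k) (g p)).
  rewrite !(T_mul_tperm hecke_H) // !permK kp ltnSn -commute (T_mul hecke_H) //.
  apply: (young_length_mul mb) inc_b; exact: young_tperm.
rewrite scale1r -!mulrA [X in h * X]mulrA mulrDl mul1r Tcommute -[X in X + _]mulr1 -mulrDr.
rewrite -mulrA [X in T g * X]mulrA (sym_alt_orthogonal gp) mul0r !mulr0 //.
Qed.

End Vanishing.

(** * Cardinals by labels *)

Section Counting.
Local Open Scope nat_scope.

Lemma card_by_label (I : finType) (A : {set I}) (f : I -> nat) n :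
    (forall x, x \in A -> f x < n) ->
  #|A| = \sum_(i < n) #|[set x in A | f x == i]|.
Proof.
move=> lt; rewrite -sum1_card.
have -> : \sum_(i < n) #|[set x in A | f x == i]| =
    \sum_(i < n) \sum_(x in A) (f x == i :> nat).
  apply: eq_bigr => i _; rewrite -sum1_card big_mkcond [RHS]big_mkcond /=.
  by apply: eq_bigr => x _; rewrite inE; case: (x \in A) => //=; case: (_ == _).
rewrite exchange_big /=; apply: eq_bigr => x xA.
rewrite (bigD1 (Ordinal (lt x xA))) //= eqxx big1 // => i ne.
by apply/eqP; rewrite eqb0; apply: contraNneq ne => e; apply/eqP/val_inj.
Qed.

Lemma sum_lt_min m n : \sum_(a < m) (a < n) = minn m n.
Proof. by elim: m => [|m IH]; rewrite ?big_ord0 ?big_ord_recr /= ?IH; lia. Qed.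

Lemma card_ord_lt r a : a <= r -> #|[set k : 'I_r | k < a]| = a.
Proof.
move=> le; rewrite -sum1_card big_mkcond /= -[RHS](minn_idPr le) -sum_lt_min.
by apply: eq_bigr => k _; rewrite inE; case: ifP.
Qed.

Lemma card_ord_range r a b : b <= r -> #|[set k : 'I_r | a <= k < b]| = b - a.
Proof.
move=> le; have [ab|ba] := leqP a b; last first.
  by apply/eqP; rewrite (eqP (_ : b - a == 0)) ?cards_eq0; [|lia];
    apply/eqP/setP => k; rewrite !inE; lia.
have := cardsID [set k : 'I_r | k < a] [set k : 'I_r | k < b].
rewrite (card_ord_lt le) (_ : _ :&: _ = [set k : 'I_r | k < a]); last first.
  by apply/setP => k; rewrite !inE; lia.
rewrite card_ord_lt ?(leq_trans ab) // => e.
rewrite -[X in X - a]e addKn; congr #|pred_of_set _|; apply/setP => k; rewrite !inE; lia.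
Qed.

End Counting.

(** * The blocks of a composition *)

Section Labels.
Local Open Scope nat_scope.
Context (r : nat) (lam : nat -> nat) (hc : is_composition r lam).
Context (hs : forall i, 0 < lam i -> i < r).
Implicit Types (i j : nat) (k : 'I_r) (w : 'S_r).

(** The index of the block of [k]: the number of blocks that end before [k]. *)
Definition label k : nat := \sum_(i < r) (row_entry lam i.+1 0 <= k).

Lemma label_monotone : monotone label.
Proof.
move=> k k' le; apply: leq_sum => i _.
by case e: (_ <= k) => //; rewrite (leq_trans e).
Qed.

Lemma label_entry k i j : j < lam i -> k = row_entry lam i j :> nat -> label k = i.
Proof.
move=> lt e; have lt_i : i < r by apply: hs; apply: leq_ltn_trans lt.
have -> : label k = \sum_(a < r) (a < i).
  apply: eq_bigr => a _; rewrite e /row_entry addn0; congr nat_of_bool.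
  case: ltnP => le; first by rewrite (leq_trans (psum_homo _ le)) ?leq_addr.
  apply/negbTE; rewrite -ltnNge; apply: leq_trans (psum_homo _ (le : i.+1 <= a.+1)).
  by rewrite big_ord_recr /= ltn_add2l.
by rewrite sum_lt_min (minn_idPr _) // ltnW.
Qed.

Lemma label_row_entry k : exists2 j, j < lam (label k) & k = row_entry lam (label k) j :> nat.
Proof.
have [[i j] /= /andP[lt /eqP e]] := row_entry_ex k hc.
by rewrite (label_entry lt e); exists j.
Qed.

Lemma block_label i : block r lam i = [set k : 'I_r | label k == i].
Proof.
apply/setP => k; rewrite !inE /row_entry !addn0 big_ord_recr /=.
apply/idP/eqP => [/andP[le lt]|<-]; last first.
  by have [j lt ->] := label_row_entry k; rewrite /row_entry leq_addr ltn_add2l.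
apply: (@label_entry k i (k - \sum_(a < i) lam a)); first by rewrite ltn_subLR.
by rewrite /row_entry subnKC.
Qed.

Lemma young_subgroupE : young_subgroup r lam = young label.
Proof.
apply/setP => w; rewrite inE; apply/asboolP/youngP => [h k|h i].
  have : w k \in w @: block r lam (label k) by rewrite imset_f // block_label inE.
  by rewrite h block_label inE => /eqP.
apply/eqP; rewrite eqEcard card_imset ?leqnn ?andbT; last exact: perm_inj.
apply/subsetP => _ /imsetP[k + ->]; by rewrite block_label !inE h.
Qed.

Lemma card_block_le i : #|[set k : 'I_r | label k == i]| <= lam i.
Proof.
rewrite -block_label /block card_ord_range; last first.
  by rewrite /row_entry addn0 composition_psum_le.
by rewrite /row_entry big_ord_recr /=; lia.
Qed.

End Labels.

(** * The diagram of a partition *)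

Section Diagram.
Local Open Scope nat_scope.
Context (r : nat) (lam : nat -> nat).
Context (hc : is_composition r lam) (hp : is_partition lam).
Implicit Types (i j : nat) (k : 'I_r) (d g v w : 'S_r).

Let mu := conj_part r lam.
Let w_lam := w_part r lam.

Lemma part_supp i : 0 < lam i -> i < r.
Proof. exact: (part_row_bound hc hp). Qed.

Lemma conj_supp j : 0 < mu j -> j < r.
Proof.
rewrite /mu /conj_part; case: (ltnP j r) => // le.
rewrite big1 // => a _; apply/eqP; rewrite eqb0; apply/negP => /(part_col_bound hc).
by rewrite ltnNge le.
Qed.

Lemma conj_composition : is_composition r mu.
Proof.
exists r => m le; rewrite -[RHS](sum_conj_part hc hp) -(subnKC le) big_split_ord /=.
rewrite [X in _ + X]big1 ?addn0 // => a _; apply/eqP; rewrite -leqn0 leqNgt.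
by apply/negP => /conj_supp; rewrite ltnNge leq_addr.
Qed.

(** The boxes of the diagram are numbered in two ways, along the rows and along
    the columns, and [w_lam] sends the first number of a box to the second.
    Everything below refers to a box by its number along the columns. *)
Definition box_row k : nat := label lam (w_lam^-1%g k).
Definition box_col k : nat := label mu k.

Lemma col_monotone : monotone box_col. Proof. exact: label_monotone. Qed.

Lemma row_w k : box_row (w_lam k) = label lam k.
Proof. by rewrite /box_row permK. Qed.

Lemma box_row_entry k :
  box_col (w_lam k) < lam (label lam k) /\
  k = row_entry lam (label lam k) (box_col (w_lam k)) :> nat.
Proof.
have [j lt e] := label_row_entry hc part_supp k.
have ew := w_partP hc hp lt e.
by rewrite /box_col (label_entry conj_supp (conj_partP hc hp lt) ew).
Qed.

Lemma box_lam k : box_col k < lam (box_row k).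
Proof. by have [+ _] := box_row_entry (w_lam^-1%g k); rewrite permKV. Qed.

Lemma col_entry k : k = row_entry mu (box_col k) (box_row k) :> nat.
Proof.
have [lt e] := box_row_entry (w_lam^-1%g k); have := w_partP hc hp lt e.
by rewrite -/w_lam permKV.
Qed.

Lemma row_lt k : box_row k < r.
Proof. by apply: part_supp; apply: leq_ltn_trans (box_lam k). Qed.

Lemma col_lt k : box_col k < r.
Proof. exact (part_col_bound hc (box_lam k)). Qed.

Lemma box_ex i j : j < lam i -> exists k, box_row k = i /\ box_col k = j.
Proof.
move=> lt; have lt_r : row_entry lam i j < r.
  apply: leq_trans (composition_psum_le i.+1 hc).
  by rewrite big_ord_recr /= ltn_add2l.
exists (w_lam (Ordinal lt_r)); rewrite row_w.
have e := label_entry part_supp lt (erefl (val (Ordinal lt_r))).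
have [lt' e'] := box_row_entry (Ordinal lt_r); rewrite e in lt' e' *; split=> //.
by have [] := row_entry_inj lt lt' e'.
Qed.

Lemma box_inj k k' : box_row k = box_row k' -> box_col k = box_col k' -> k = k'.
Proof.
by move=> er ec; apply: val_inj; rewrite /= (col_entry k) (col_entry k') er ec.
Qed.

Lemma same_col_lt k k' : box_col k = box_col k' -> (k < k') = (box_row k < box_row k').
Proof. by move=> e; rewrite (col_entry k) (col_entry k') e /row_entry ltn_add2l. Qed.

Lemma w_lam_increasing : increasing_on (label lam) w_lam.
Proof.
apply/increasing_onP => k k' lt e.
have [_ ek] := box_row_entry k; have [_ ek'] := box_row_entry k'.
rewrite ltnNge; apply/negP => /col_monotone le; move: lt.
by rewrite ek ek' e /row_entry ltn_add2l ltnNge le.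
Qed.

(** The order of the boxes of a column is that of their rows, and row
    permutations do not mix the rows. *)
Lemma w_lamV_increasing v : v \in young (label lam) ->
  increasing_on box_col (v * w_lam)^-1%g.
Proof.
rewrite -youngV => /youngP hv; apply/increasing_onP => k k' lt e.
rewrite invMg !permM ltnNge; apply/negP => /(label_monotone lam).
by rewrite !hv -/(box_row _) leqNgt -same_col_lt // lt.
Qed.

Lemma row_col_preserving_eq1 v : v \in young box_row -> v \in young box_col -> v = 1%g.
Proof.
by move=> /youngP hr /youngP hc'; apply/permP => k; rewrite perm1; apply: box_inj.
Qed.

(** A permutation [d] is read as the filling with entry [d k] in box [k]. *)
Definition row_increasing d : bool :=
  [forall k : 'I_r, forall k' : 'I_r,
    (box_row k == box_row k') ==> (box_col k < box_col k') ==> (d k < d k')].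

Definition standard d : bool := increasing_on box_col d && row_increasing d.

Lemma row_increasingP d :
  reflect (forall k k', box_row k = box_row k' -> box_col k < box_col k' -> d k < d k')
    (row_increasing d).
Proof.
apply: (iffP forallP) => [h k k' eq lt|h k].
  by have /forallP/(_ k') := h k; rewrite lt eq eqxx.
by apply/forallP => k'; apply/implyP => /eqP eq; apply/implyP => lt; apply: h.
Qed.

(** Since the row of a partition has no gaps, a violation can be found at
    neighbours. *)
Lemma row_violation d : ~~ row_increasing d ->
  exists k1 k2, [/\ box_row k1 = box_row k2, box_col k2 = (box_col k1).+1 & d k2 < d k1].
Proof.
apply: contraNP => no_viol; apply/row_increasingP => k k'.
have [n] := ubnP (box_col k'); elim: n k' => // n IH k' lt_n er lt.
have lt_p : (box_col k').-1 < lam (box_row k').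
  by apply: leq_ltn_trans (box_lam k'); rewrite leq_pred.
have [p [rp cp]] := box_ex lt_p.
have cp' : box_col k' = (box_col p).+1 by rewrite cp prednK // (leq_ltn_trans _ lt).
have pk' : d p < d k'.
  rewrite ltn_neqAle; apply/andP; split.
    by apply/eqP => /val_inj/perm_inj e; move: cp'; rewrite e; lia.
  by rewrite leqNgt; apply/negP => lt'; apply: no_viol; exists p, k'.
have [kp|pk] := ltnP (box_col k) (box_col p).
  by apply: ltn_trans pk'; apply: IH => //; [lia|rewrite rp].
by rewrite (_ : k = p) //; apply: box_inj; [rewrite rp|lia].
Qed.

Section Garnir.

Context (k1 k2 : 'I_r) (er : box_row k1 = box_row k2) (ec : box_col k2 = (box_col k1).+1).

(** The Garnir belt, the interval from [k1] to [k2], consists of the boxes of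
    the column of [k1] from [k1] on and those of the next column up to [k2]. It
    is one block of this label, the remaining parts of the columns are the
    others; the doubling makes room for the belt between two columns. *)
Definition garnir_label k : nat :=
  if k < k1 then (box_col k).*2 else if k <= k2 then (box_col k1).*2.+1 else (box_col k).*2.

Lemma garnir_monotone : monotone garnir_label.
Proof.
clear er.
move=> k k' le; have := col_monotone le; rewrite /garnir_label.
case: (ltnP k k1) => h1; case: (ltnP k' k1) => h1'; case: (leqP k k2) => h2;
  case: (leqP k' k2) => h2'; try lia.
- by have := col_monotone (ltnW h1); lia.
- by have := col_monotone (ltnW h2'); lia.
Qed.

Lemma garnir_same_block k k' : garnir_label k = garnir_label k' -> box_col k <> box_col k' ->
  [/\ k1 <= k <= k2 & k1 <= k' <= k2].
Proof.
clear er ec.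
rewrite /garnir_label.
case: (ltnP k k1) => h1; case: (ltnP k' k1) => h1'; case: (leqP k k2) => h2;
  case: (leqP k' k2) => h2'; try lia; by [].
Qed.

(** The columns before that of [k1] and the belt are [col k1 + 1] blocks, with
    one point more than there are boxes in the first [col k1 + 1] columns. If
    each row met these blocks in distinct ones, the row of length [n] would hold
    at most [minn (col k1 + 1) n] of their points, and the sum of these numbers
    is the number of boxes in the first [col k1 + 1] columns. *)
Lemma garnir_pigeonhole g : exists k k', [/\ k != k', label lam k = label lam k' &
  garnir_label (g k) = garnir_label (g k')].
Proof.
pose j := box_col k1; pose start := row_entry mu j 0.
pose U : {set 'I_r} := [set k : 'I_r | k < start] :|: [set k : 'I_r | k1 <= k < k2.+1].
have e1 := col_entry k1; have e2 := col_entry k2.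
have le1 : start <= k1 by rewrite e1 /start /row_entry leq_add2l.
have k12 : k1 < k2.
  by rewrite ltnNge; apply/negP => /col_monotone; rewrite ec ltnn.
have cardU : #|U| = (row_entry mu j.+1 0).+1.
  rewrite cardsU (_ : _ :&: _ = set0) ?cards0 ?subn0; last first.
    by apply/setP => k; rewrite !inE; lia.
  rewrite card_ord_lt ?card_ord_range ?(leq_trans le1) // 1?ltnW //.
  by move: e1 e2; rewrite /start ec -er -/j /row_entry big_ord_recr /=; lia.
(* On [U] the label is determined by a number at most [j]: the column before
   the belt, and [j] on the belt. *)
have before k : k < start -> k < k1 /\ box_col k < j.
  move=> lt; split; first exact: leq_trans le1.
  rewrite ltnNge; apply/negP => /(psum_homo mu) le; move: lt.
  by rewrite (col_entry k) /start /row_entry addn0 ltnNge (leq_trans le) ?leq_addr.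
pose m k := if k < k1 then box_col k else j.
have m_le k : k \in U -> m k < j.+1.
  rewrite !inE /m => /orP[/before[-> /ltnW//]|/andP[le _]].
  by rewrite [k < k1]ltnNge le.
have m_label k k' : k \in U -> k' \in U -> m k = m k' -> garnir_label k = garnir_label k'.
  rewrite !inE !ltnS /m /garnir_label.
  move=> /orP[/before[-> lt]|/andP[le ->]]; move=> /orP[/before[-> lt']|/andP[le' ->]] //;
    rewrite ?[_ < k1]ltnNge ?le ?le' //=.
  - by move->.
  - by move=> e; rewrite e ltnn in lt.
  - by move=> e; rewrite -e ltnn in lt'.
have [/existsP[k /existsP[k' /and3P[neq /eqP eb /eqP eg]]]|no] :=
  boolP [exists k : 'I_r, exists k' : 'I_r, [&& k != k', label lam k == label lam k' &
    garnir_label (g k) == garnir_label (g k')]]; first by exists k, k'.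
suff : #|U| <= row_entry mu j.+1 0 by rewrite cardU ltnn.
have lab_lt k : label lam k < r by rewrite -row_w row_lt.
rewrite -(on_card_preimset (f := g)); last first.
  by exists g^-1%g => k _; rewrite ?permK ?permKV.
rewrite (card_by_label (f := label lam) (n := r)) => [|k _]; last exact: lab_lt.
have -> : row_entry mu j.+1 0 = \sum_(i < r) minn j.+1 (lam i).
  rewrite /row_entry addn0 /mu /conj_part exchange_big /=.
  by apply: eq_bigr => i _; rewrite sum_lt_min.
apply: leq_sum => i _; rewrite leq_min; apply/andP; split.
  pose f k : 'I_j.+1 := inord (m (g k)).
  rewrite -(card_in_imset (f := f)); first by rewrite -[X in _ <= X]card_ord max_card.
  move=> k k'; rewrite !inE => /andP[hk /eqP lk] /andP[hk' /eqP lk'] e.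
  apply/eqP; apply: contraNT no => neq; apply/existsP; exists k; apply/existsP; exists k'.
  rewrite neq lk lk' eqxx /=; apply/eqP; apply: m_label; rewrite ?inE //.
  by move/(congr1 val): e; rewrite /f /= !inordK ?m_le // !inE.
apply: leq_trans (card_block_le hc part_supp i); apply: subset_leq_card.
by apply/subsetP => k; rewrite !inE => /andP[].
Qed.

End Garnir.
End Diagram.

(** * Straightening *)

Section Straightening.
Local Open Scope ring_scope.
Context (R : idomainType) (q : R) (r : nat) (H : algType R) (T : 'S_r -> H).
Context (hecke_H : is_hecke_algebra q T) (q_unit : q \is a GRing.unit).
Context (lam : nat -> nat) (hc : is_composition r lam) (hp : is_partition lam).
Implicit Types (u v w d g : 'S_r) (i j k : 'I_r) (h : H).

Let z := z_elt q T lam.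
Let row := box_row (r := r) lam.
Let col := box_col (r := r) lam.

Lemma z_eltE : z = psum T (label lam) 1 * T (w_part r lam) * psum T col (- q)^-1.
Proof.
rewrite /z /z_elt /x_elt /y_elt (young_subgroupE hc (part_supp hc hp)).
rewrite (young_subgroupE (conj_composition hc hp) (conj_supp hc)); congr (_ * _ * _).
  by apply: eq_bigr => w _; rewrite expr1n scale1r.
by apply: eq_bigr => w _; rewrite exprVn.
Qed.

Definition standard_span h : Prop :=
  exists c : 'S_r -> R, h = \sum_(d | standard lam d) c d *: (z * T d).

Lemma standard_span_scale a h : standard_span h -> standard_span (a *: h).
Proof.
move=> [c ->]; exists (fun d => a * c d); rewrite scaler_sumr.
by apply: eq_bigr => d _; rewrite scalerA.
Qed.

Lemma standard_span_sum (P : pred 'S_r) (F : 'S_r -> H) :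
  (forall d, P d -> standard_span (F d)) -> standard_span (\sum_(d | P d) F d).
Proof.
move=> hF; apply: (big_ind standard_span) => //.
  by exists (fun=> 0); rewrite big1 // => d _; rewrite scale0r.
move=> _ _ [c ->] [c' ->]; exists (fun d => c d + c' d); rewrite -big_split.
by apply: eq_bigr => d _; rewrite scalerDl.
Qed.

Lemma standard_span_T d : standard lam d -> standard_span (z * T d).
Proof.
move=> sd; exists (fun d' => (d' == d)%:R); rewrite (bigD1 d) //= eqxx scale1r.
by rewrite big1 ?addr0 // => d' /andP[_ /negbTE->]; rewrite scale0r.
Qed.

Section Garnir.

Context (k1 k2 : 'I_r) (er : row k1 = row k2) (ec : col k2 = (col k1).+1).

Let nu := garnir_label lam k1 k2.
(* As both labels are monotone, two points with the same sum of labels have the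
   same value of each. *)
Let fine k : nat := (col k + nu k)%N.

Lemma fine_monotone : monotone fine.
Proof. by move=> k k' le; apply: leq_add; [apply: col_monotone | apply: garnir_monotone]. Qed.

Lemma fine_eq k k' : fine k = fine k' -> col k = col k' /\ nu k = nu k'.
Proof.
rewrite /fine => e; have := @col_monotone r lam k k'; have := @col_monotone r lam k' k.
have := @garnir_monotone r lam k1 k2 ec k k'; have := @garnir_monotone r lam k1 k2 ec k' k.
rewrite -/col -/nu; move=> g1 g2 c1 c2; case/orP: (leq_total k k') => le.
  by have := g2 le; have := c2 le; lia.
by have := g1 le; have := c1 le; lia.
Qed.

(** The shortest coset representatives of [young fine] in [young nu], that is, of
    the column stabilizer of the belt in the symmetric group of the belt. *)
Definition garnir_set : {set 'S_r} := [set d in young nu | increasing_on fine d].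

(** The column sum in [z] has the alternating sum over [young fine] as a right
    factor, which the Garnir sum completes to the alternating sum over
    [young nu]; by the pigeonhole principle that is orthogonal to the row sum. *)
Lemma garnir_relation :
  z * (\sum_(d in garnir_set) (- q)^-1 ^+ length d *: T d) = 0.
Proof.
rewrite z_eltE (psum_factor_right hecke_H (b := col) (b' := fine) _ fine_monotone); last first.
  by move=> k k' /fine_eq[].
have -> : \sum_(d in garnir_set) (- q)^-1 ^+ length d *: T d =
    \sum_(d in young nu | increasing_on fine d) (- q)^-1 ^+ length d *: T d.
  by apply: eq_bigl => d; rewrite [in LHS]inE.
rewrite -!mulrA -(psum_factor_left hecke_H (b := nu) _ fine_monotone); last first.
  by move=> k k' /fine_eq[].
set h := (X in T _ * (X * _)); rewrite !mulrA -[_ * T _ * h]mulrA.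
have vanish g : psum T (label lam) 1 * T g * psum T nu (- q)^-1 = 0.
  have [k [k' [neq ek eg]]] := garnir_pigeonhole hc hp er ec g.
  apply: (sym_T_alt_eq0 hecke_H q_unit _ _ neq ek eg); first exact: label_monotone.
  exact: garnir_monotone.
rewrite (coordsE hecke_H (T _ * h)).
move: (psum _ _ 1) (psum _ nu _) vanish => x y vanish.
rewrite mulr_sumr mulr_suml big1 // => g _.
by rewrite -scalerAr -scalerAl vanish scaler0.
Qed.

(** When the filling [w] violates the rows at the belt, its entries in the
    second column of the belt all precede those in the first, so the part [d0]
    of [w] in the symmetric group of the belt has all inversions that elements
    of [garnir_set] can have. *)
Lemma garnir_factor w : increasing_on col w -> (w k2 < w k1)%N ->
  exists d0 w', [/\ w = (d0 * w')%g, d0 \in garnir_set, increasing_on nu w' &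
    forall d, d \in garnir_set -> d != d0 -> (length d < length d0)%N].
Proof.
move=> inc viol; have mnu : monotone nu by apply: garnir_monotone.
have [u hu inc_w'] := young_coset_min w mnu.
have [d0 [w' [ew d0nu {}inc_w']]] :
    exists d0 w', [/\ w = (d0 * w')%g, d0 \in young nu & increasing_on nu w'].
  by exists u^-1%g, (u * w)%g; rewrite mulKg youngV.
have /youngP hd0 := d0nu.
have d0w k k' : nu k = nu k' -> (d0 k < d0 k')%N = (w k < w k')%N.
  by move=> e; rewrite ew !permM (increasing_on_lt inc_w') ?hd0.
exists d0, w'; split=> // [|d].
  rewrite inE d0nu; apply/increasing_onP => k k' lt /fine_eq[ek enu].
  by rewrite d0w // (increasing_on_lt inc).
rewrite inE => /andP[/youngP hd /increasing_onP inc_d] neq.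
apply: length_lt_sub => //; apply/subsetP => -[k k']; rewrite !inE /= => /andP[lt lt'].
rewrite lt /=.
have enu : nu k = nu k'.
  have := mnu _ _ (ltnW lt); have := mnu _ _ (ltnW lt'); rewrite !hd => le2 le1.
  by apply/eqP; rewrite eqn_leq le1.
rewrite d0w //.
have ncol : col k <> col k'.
  move=> ek; have := inc_d _ _ lt; rewrite /fine ek enu => /(_ erefl).
  by rewrite ltnNge (ltnW lt').
have [/andP[le1 le2] /andP[le1' le2']] := garnir_same_block enu ncol.
have := col_monotone lam le1; have := col_monotone lam le2'.
have := col_monotone lam (ltnW lt); rewrite -/col ec => c1 c2 c3.
have ck : col k1 = col k by lia.
have ck' : col k' = col k2 by lia.
have le k3 k4 : col k3 = col k4 -> (k3 <= k4)%N -> (w k3 <= w k4)%N.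
  by move=> e le34; rewrite leqNgt (increasing_on_lt inc) ?e // -leqNgt.
by apply: leq_ltn_trans (le _ _ ck' le2') _; apply: leq_trans viol _; apply: le.
Qed.

Lemma garnir_straighten w : increasing_on col w -> (w k2 < w k1)%N ->
  (forall v, (length v < length w)%N -> standard_span (z * T v)) ->
  standard_span (z * T w).
Proof.
move=> inc viol IH; have [d0 [w' [ew d0G inc_w' shorter]]] := garnir_factor inc viol.
have mnu : monotone nu by apply: garnir_monotone.
have lenG d : d \in garnir_set -> length (d * w')%g = (length d + length w')%N.
  by rewrite inE => /andP[hd _]; apply: young_length_mul mnu hd inc_w'.
(* The term of [d0] in the Garnir relation times [T w'] is a multiple of
   [z * T w], the other terms belong to shorter permutations. *)
have pull a h h' : z * ((a *: h) * h') = a *: (z * (h * h')).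
  by rewrite -[(a *: h) * h']scalerAl -[z * (a *: _)]scalerAr.
have := congr1 ( *%R^~ (T w')) garnir_relation; rewrite /= mul0r -mulrA mulr_suml.
rewrite (bigD1 d0) //= mulrDr pull => /eqP; rewrite addr_eq0 => /eqP.
have -> : T d0 * T w' = T w by rewrite (T_mul hecke_H) ?lenG // -ew.
move=> e.
pose x := (- q)^-1; have x_unit : x ^+ length d0 \is a GRing.unit.
  by rewrite unitrX // unitrV unitrN.
rewrite -[z * T w]scale1r -(mulVr x_unit) -scalerA e -scaleN1r.
do 2 apply: standard_span_scale; rewrite mulr_sumr.
apply: standard_span_sum => d /andP[dG neq]; rewrite pull.
apply: standard_span_scale; rewrite (T_mul hecke_H) ?lenG //; apply: IH.
by rewrite ew !lenG // ltn_add2r shorter.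
Qed.

End Garnir.

(** Straightening: descents within columns change [z] by a sign, and the Garnir
    relations express violations of the rows by shorter permutations. *)
Lemma standard_span_all w : standard_span (z * T w).
Proof.
have [n] := ubnP (length w); elim: n w => // n IH w lt_n.
have IHw v : (length v < length w)%N -> standard_span (z * T v).
  by move=> lt; apply: IH; apply: leq_trans lt _.
have [inc|/(descent_ex (@col_monotone r lam))[i [j [ij e lt]]]] := boolP (increasing_on col w).
  have [row_inc|/(row_violation hc hp)[k1 [k2 [er ec viol]]]] := boolP (row_increasing lam w).
    by apply: standard_span_T; rewrite /standard inc.
  exact: (garnir_straighten er ec).
have lw := left_descent ij lt.
have -> : T w = T (tperm i j) * T (tperm i j * w)%g.
  by rewrite (T_mul hecke_H) mulgA tperm2 mul1g // length_tperm // lw addnC.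
have -> : z * (T (tperm i j) * T (tperm i j * w)%g) = - (z * T (tperm i j * w)%g).
  by rewrite mulrA z_eltE -mulrA -mulrA [_ * (T _ * _)]mulrA
    (alt_mul_T hecke_H q_unit ij e) mulNr !mulrN !mulrA.
rewrite -scaleN1r; apply: standard_span_scale; apply: IHw.
by rewrite lw addn1.
Qed.

End Straightening.

(** * Triangularity *)

Section Triangularity.
Context (r : nat) (lam : nat -> nat).
Context (hc : is_composition r lam) (hp : is_partition lam).
Implicit Types (u v w d : 'S_r) (j m : nat) (k : 'I_r).
Local Open Scope nat_scope.

Let row := box_row (r := r) lam.
Let col := box_col (r := r) lam.
Let w_lam := w_part r lam.

Lemma col_ltE j k : (k < row_entry (conj_part r lam) j 0) = (col k < j).
Proof.
rewrite [X in X < _](col_entry hc hp) -/row -/col /row_entry addn0.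
case: (ltnP (col k)) => [lt|le]; last first.
  by rewrite ltnNge (leq_trans (psum_homo _ le)) ?leq_addr.
apply: leq_trans (psum_homo _ lt); rewrite big_ord_recr /= ltn_add2l.
exact: (conj_partP hc hp (box_lam hc hp k)).
Qed.

(** Counting only up to the ends of columns makes the counts invariant under
    column permutations. *)
Definition colcnt d j m : nat := cnt d (row_entry (conj_part r lam) j 0) m.

Lemma colcntE d j m : colcnt d j m = #|[set k : 'I_r | (col k < j) && (d k < m)]|.
Proof. by congr #|pred_of_set _|; apply/setP => k; rewrite !inE col_ltE. Qed.

Lemma colcnt_col u d j m : u \in young col -> colcnt (u * d)%g j m = colcnt d j m.
Proof.
move=> /youngP hu; rewrite !colcntE -[RHS](on_card_preimset (f := u)); last first.
  by exists u^-1%g => k _; rewrite ?permK ?permKV.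
by congr #|pred_of_set _|; apply/setP => k; rewrite !inE permM hu.
Qed.

(** In a row of a standard filling, the first boxes hold the small entries, so
    no permutation within the rows moves more small entries to the left. *)
Lemma colcnt_row v d j m : v \in young row -> row_increasing lam d ->
  colcnt (v * d)%g j m <= colcnt d j m.
Proof.
move=> /youngP hv /row_increasingP inc; rewrite !colcntE.
rewrite (card_by_label (f := row) (n := r)); last by move=> k _; apply: row_lt.
rewrite [X in _ <= X](card_by_label (f := row) (n := r)); last by move=> k _; apply: row_lt.
apply: leq_sum => i _; pose A := [set k : 'I_r | (row k == i) && (col k < j)].
pose B := [set k : 'I_r | (row k == i) && (d k < m)].
have -> : [set k in [set k : 'I_r | (col k < j) && (d k < m)] | row k == i] = A :&: B.
  by apply/setP => k; rewrite !inE; case: (row k == i); rewrite ?andbF ?andbT.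
have -> : [set k in [set k : 'I_r | (col k < j) && ((v * d)%g k < m)] | row k == i] =
    A :&: v @^-1: B.
  by apply/setP => k; rewrite !inE permM hv; case: (row k == i); rewrite ?andbF ?andbT.
have cardB : #|v @^-1: B| = #|B|.
  by apply: on_card_preimset; exists v^-1%g => k _; rewrite ?permK ?permKV.
have [sAB|] := boolP (A \subset B).
  by rewrite (setIidPl sAB) subset_leq_card ?subsetIl.
case/subsetPn => k; rewrite !inE => /andP[/eqP rk ck]; rewrite rk eqxx /= -leqNgt => le_m.
suff sBA : B \subset A by rewrite (setIidPr sBA) -cardB subset_leq_card ?subsetIr.
apply/subsetP => k'; rewrite !inE => /andP[/eqP rk' lt_m]; rewrite rk' eqxx /=.
rewrite ltnNge; apply/negP => le_j; have : d k < d k'.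
  by apply: inc; rewrite -/row ?rk ?rk' // -/col (leq_trans ck).
by rewrite ltnNge (leq_trans (ltnW lt_m)).
Qed.

(** The counts determine the column of each entry, and the columns are sorted. *)
Lemma colcnt_inj d d' : increasing_on col d -> increasing_on col d' ->
    (forall j m, j <= r -> m <= r -> colcnt d j m = colcnt d' j m) -> d = d'.
Proof.
move=> inc inc' e; have ecol p : col (d^-1%g p) = col (d'^-1%g p).
  have lt_j j : j <= r -> (col (d^-1%g p) < j) = (col (d'^-1%g p) < j).
    move=> le; have := e j p.+1 le (ltn_ord p); have := e j p le (ltnW (ltn_ord p)).
    rewrite /colcnt !cntS => -> /addnI; rewrite !col_ltE.
    by case: (_ < j); case: (_ < j).
  have lt k : col k < r by apply: col_lt.
  apply/eqP; rewrite eqn_leq -ltnS -[X in _ && X]ltnS lt_j ?lt // ltnSn /=.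
  by rewrite -lt_j ?lt.
have hu : (d * d'^-1)%g \in young col.
  by apply/youngP => k; rewrite permM -ecol permK.
have eu : (d * d'^-1 * d')%g = d by rewrite mulgKV.
have e1 := young_coset_uniq (@col_monotone r lam) hu inc' inc eu.
by rewrite -[LHS]eu e1 mul1g.
Qed.

(** A number that is strictly monotone for the dominance order of fillings. *)
Definition dominance d : nat := \sum_(j < r.+1) \sum_(m < r.+1) colcnt d j m.

Lemma dominance_le d d' : (forall j m, colcnt d j m <= colcnt d' j m) ->
  dominance d <= dominance d' ?= iff
    [forall j : 'I_r.+1, forall m : 'I_r.+1, colcnt d j m == colcnt d' j m].
Proof.
move=> le.
have le_j (j : 'I_r.+1) : true ->
    \sum_(m < r.+1) colcnt d j m <= \sum_(m < r.+1) colcnt d' j m ?= iff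
    [forall m : 'I_r.+1, colcnt d j m == colcnt d' j m].
  move=> _; apply: (leqif_sum (P := predT)) => m _; split=> //; exact: le.
by have := leqif_sum le_j.
Qed.

Local Open Scope ring_scope.
Context (R : idomainType) (q : R) (H : algType R) (T : 'S_r -> H).
Context (hecke_H : is_hecke_algebra q T) (q_unit : q \is a GRing.unit).

Let z := z_elt q T lam.

(** Lengths add in [v * w_lam * u]. *)
Lemma z_elt_expand : z = \sum_(v in young (label lam)) \sum_(u in young col)
  (- q)^-1 ^+ length u *: T (v * w_lam * u)%g.
Proof.
rewrite /z z_eltE // /psum !mulr_suml; apply: eq_bigr => v hv.
rewrite mulr_sumr; apply: eq_bigr => u hu.
rewrite expr1n scale1r -scalerAr; congr (_ *: _).
rewrite (T_mul hecke_H); last first.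
  by rewrite (young_length_mul (@label_monotone r lam) hv) // w_lam_increasing.
rewrite (T_mul hecke_H) //.
by rewrite (young_length_mulV (@col_monotone r lam) hu) // w_lamV_increasing.
Qed.

Lemma young_row_conj v : v \in young (label lam) -> (w_lam^-1 * v * w_lam)%g \in young row.
Proof. by move=> /youngP hv; apply/youngP => k; rewrite !permM /row row_w hv. Qed.

(** The permutation [b] is the only one for which the first equation holds. As
    [u * b] arises from [d'] by permuting boxes within rows, it has no more
    small entries on the left than [d']. *)
Lemma coef_term_below v u d d' : v \in young (label lam) -> u \in young col ->
    row_increasing lam d' ->
    coef hecke_H (w_lam * d')%g (T (v * w_lam * u)%g * T d) != 0 ->
  exists b, [/\ (v * w_lam * u * b = w_lam * d')%g, below b d,
    forall j m, (colcnt d j m <= colcnt b j m)%N &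
    forall j m, (colcnt b j m <= colcnt d' j m)%N].
Proof.
move=> hv hu inc nz; pose b := ((v * w_lam * u)^-1 * (w_lam * d'))%g.
have eb : (v * w_lam * u * b = w_lam * d')%g by rewrite /b mulKVg.
rewrite -eb in nz; have below_b := coef_mul_below nz.
exists b; split=> // [j m|j m]; first by have [_] := below_b; apply.
rewrite -(colcnt_col b j m hu).
have -> : (u * b = w_lam^-1 * v^-1 * w_lam * d')%g by rewrite -mulgA -eb !mulgA mulgKV mulVg mul1g.
by apply: colcnt_row inc; rewrite young_row_conj ?youngV.
Qed.

Lemma coef_z_triangular d d' : standard lam d -> standard lam d' ->
    coef hecke_H (w_lam * d')%g (z * T d) != 0 ->
  d = d' \/ (dominance d < dominance d')%N.
Proof.
move=> /andP[inc _] /andP[inc' rinc'] nz.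
have le j m : (colcnt d j m <= colcnt d' j m)%N.
  apply: contraNT nz => nle; rewrite z_elt_expand mulr_suml linear_sum big1 // => v hv.
  rewrite mulr_suml linear_sum big1 // => u hu; rewrite -scalerAl linearZ.
  apply/eqP; rewrite mulf_eq0; apply/orP; right; apply: contraNT nle.
  by move=> /(coef_term_below hv hu rinc')[b [_ _ le1 le2]]; apply: leq_trans (le2 j m).
have [dle deq] := dominance_le le.
move: dle; rewrite leq_eqVlt deq => /orP[/forallP e|]; [left|by right].
apply: colcnt_inj => // j m lj lm.
by have /forallP/(_ (Ordinal (lm : m < r.+1)%N))/eqP := e (Ordinal (lj : j < r.+1)%N).
Qed.

(** For [d' = d] all inequalities between counts are equalities, so the
    permutation [b] of [coef_term_below] is [d]; then [u] also preserves rows,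
    and only the summand with [u] and [v] trivial contributes. *)
Lemma coef_z_diag d : standard lam d ->
  coef hecke_H (w_lam * d)%g (z * T d) \is a GRing.unit.
Proof.
move=> /andP[inc rinc].
have vanish v u : v \in young (label lam) -> u \in young col ->
    coef hecke_H (w_lam * d)%g (T (v * w_lam * u)%g * T d) != 0 -> v = 1%g /\ u = 1%g.
  move=> hv hu /(coef_term_below hv hu rinc)[b [eb [hb _] le1 le2]].
  have e j m : colcnt b j m = colcnt d j m by apply/eqP; rewrite eqn_leq le1 le2.
  have [x hx hxb] := young_coset_min b (@col_monotone r lam).
  have exb : (x * b = d)%g.
    by apply: colcnt_inj => // j m _ _; rewrite colcnt_col.
  have lb : length b = (length x + length d)%N.
    rewrite -[b](mulKg x) exb (young_length_mul (@col_monotone r lam) _ inc) ?youngV //.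
    by rewrite lengthV.
  have ebd : b = d by case/orP: hb => [/eqP//|]; rewrite lb; lia.
  have {eb} eu : u = (w_lam^-1 * v^-1 * w_lam)%g.
    move: eb; rewrite ebd => /mulIg eb.
    by rewrite -[X in (_ * X)%g]eb !mulgA mulgKV mulVg mul1g.
  have u1 : u = 1%g.
    by apply: (row_col_preserving_eq1 hc hp) => //; rewrite eu young_row_conj ?youngV.
  split=> //; move/(congr1 (fun y => w_lam * y * w_lam^-1)%g): eu.
  rewrite u1 mulg1 mulgV !mulgA mulgV mul1g mulgK => /(congr1 (@invg _)).
  by rewrite invg1 invgK.
rewrite z_elt_expand mulr_suml linear_sum (bigD1 1%g) ?young1 //= [X in _ + X]big1 ?addr0.
  rewrite mulr_suml linear_sum (bigD1 1%g) ?young1 //= [X in _ + X]big1 ?addr0.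
    rewrite length1 expr0 scale1r mul1g mulg1; exact: coef_mul_lead.
  move=> u /andP[hu neq]; rewrite -scalerAl linearZ; apply/eqP; rewrite mulf_eq0.
  apply/orP; right; apply: contraNT neq => /(vanish _ _ (young1 _) hu)[_ ->//].
move=> v /andP[hv neq]; rewrite mulr_suml linear_sum big1 // => u hu.
rewrite -scalerAl linearZ; apply/eqP; rewrite mulf_eq0.
by apply/orP; right; apply: contraNT neq => /(vanish _ _ hv hu)[->].
Qed.

End Triangularity.

(** * Extension of functionals *)

(** The system is solved on the indices with [F] in decreasing order: the
    unknown of index [j] enters only its own equation and those with a smaller
    value of [F]. *)
Lemma triangular_solve (R : comUnitRingType) (I : finType) (P : pred I) (F : I -> nat)
    (M : I -> I -> R) :
    (forall i, P i -> M i i \is a GRing.unit) ->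
    (forall i j, P i -> P j -> M i j != 0 -> i = j \/ (F i < F j)%N) ->
  forall c : I -> R, exists a : I -> R,
    forall i, P i -> \sum_(j | P j) a j * M i j = c i.
Proof.
move=> diag tri c; pose N := (\max_i F i).+1.
have lt_N i : (F i < N)%N by rewrite ltnS leq_bigmax.
suff solve n : exists a : I -> R,
    forall i, P i -> (N <= F i + n)%N -> \sum_(j | P j) a j * M i j = c i.
  have [a ha] := solve N; exists a => i Pi; apply: ha => //; exact: leq_addl.
elim: n => [|n [a IH]].
  by exists (fun=> 0) => i _; rewrite addn0 leqNgt lt_N.
pose b j := if (F j + n.+1 == N)%N
  then (c j - \sum_(k | P k) a k * M j k) / M j j else 0.
exists (fun j => a j + b j) => i Pi; rewrite leq_eqVlt.
have -> : \sum_(j | P j) (a j + b j) * M i j =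
    \sum_(j | P j) a j * M i j + \sum_(j | P j) b j * M i j.
  by rewrite -big_split; apply: eq_bigr => j _; rewrite mulrDl.
case/orP => [/eqP eN|lt].
  rewrite [X in _ + X](bigD1 i) //= [X in _ + (_ + X)]big1 => [|j /andP[Pj neq]].
    by rewrite /b -eN eqxx divrK ?diag // addr0 subrKC.
  rewrite /b; case: eqP => [eNj|_]; last by rewrite mul0r.
  have [->|/(tri _ _ Pi Pj)[e|]] := eqVneq (M i j) 0; first by rewrite mulr0.
    by rewrite e eqxx in neq.
  lia.
rewrite [X in _ + X]big1 ?addr0 ?IH //; first by lia.
move=> j Pj; rewrite /b; case: eqP => [eNj|_]; last by rewrite mul0r.
have [->|/(tri _ _ Pi Pj)[e|]] := eqVneq (M i j) 0; first by rewrite mulr0.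
  by move: eNj lt; rewrite -e; lia.
lia.
Qed.

Theorem theorem4p2 (R : idomainType) (q : R) (r : nat) (H : algType R)
    (T : 'S_r -> H) (q_unit : q \is a GRing.unit) (r_gt0 : (0 < r)%N)
    (hecke_H : is_hecke_algebra q T) (lam : nat -> nat)
    (lam_comp : is_composition r lam) :
  forall f : C_minus1 q T lam, exists e : C_0 T lam, d_0 q e =1 f.
Proof.
move=> f; have [hp|not_part] := pselect (is_partition lam); last first.
  have lin : linear (fun _ : perm_module T lam => 0 : R^o).
    by move=> x u v; rewrite scaler0 addr0.
  pose e : C_0 T lam := HB.pack (fun _ : perm_module T lam => 0 : R^o)
    (GRing.isLinear.Build _ _ _ _ _ lin).
  exists e => u; have -> : u = 0; last by rewrite !linear0.
  have zero h : h \in specht_pred q T lam -> h = 0.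
    by rewrite unfold_in /specht_pred; case: asboolP => // _ /eqP.
  by apply: val_inj; rewrite (zero _ (valP u)).
pose z := z_elt q T lam; pose w_lam := w_part r lam.
have z_in h : z * h \in specht_pred q T lam.
  by rewrite unfold_in /specht_pred; case: asboolP => // _; apply/asboolP; exists h.
have specht_z h : h \in specht_pred q T lam -> exists h', h = z * h'.
  by rewrite unfold_in /specht_pred; case: asboolP => // _ /asboolP.
pose s d : specht_module q T lam := Sub (z * T d) (z_in (T d)).
have spanned (u : specht_module q T lam) : exists c : 'S_r -> R,
    u = \sum_(d | standard lam d) c d *: s d.
  have [h eh] := specht_z _ (valP u).
  have [c ec] : standard_span q T lam (val u).
    rewrite eh (coordsE hecke_H h) mulr_sumr; apply: standard_span_sum => d _.
    rewrite -scalerAr; apply: standard_span_scale.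
    exact: standard_span_all.
  exists c; apply: val_inj; rewrite ec linear_sum; apply: eq_bigr => d _.
  by rewrite linearZ.
have [a ha] := triangular_solve
  (coef_z_diag lam_comp hp hecke_H q_unit) (@coef_z_triangular _ _ lam_comp hp _ _ _ _ hecke_H)
  (fun d => f (s d)).
pose g (m : perm_module T lam) : R^o :=
  \sum_(d | standard lam d) a d * coef hecke_H (w_lam * d)%g (val m).
have lin : linear g.
  move=> x u v; rewrite /g scaler_sumr -big_split; apply: eq_bigr => d _.
  by rewrite linearP mulrDr /= -mulrCA.
pose e : C_0 T lam := HB.pack g (GRing.isLinear.Build _ _ _ _ _ lin).
exists e => u; have [c ->] := spanned u; rewrite !linear_sum; apply: eq_bigr => d sd.
by rewrite !linearZ; congr (_ *: _); apply: ha.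
Qed.
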